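(* For every $n\geq 1$, $|\mathcal{D}_n^1(321)|=|\mathcal{D}_n^1(132)|$. Moreover, $$1+\sum_{n\geq 1}|\mathcal{D}_n^1(321)|x^n=\frac{1-3x+3x^2+2x^3+(x^2+x-1)\sqrt{1-4x}}{2x^2(1-x)(2+x)}.$$
   Context: $\mathfrak{S}_n$ is the set of permutations of $[n]=\{1,\dots,n\}$, with $\mathrm{FIX}(\pi)=\{i:\pi(i)=i\}$. For $\pi\in\mathfrak{S}_n$, consider the word obtained from $\pi(1)\cdots\pi(n)$ by replacing $\pi(i)$ with $-1$ for every $i\in\mathrm{FIX}(\pi)$, and then replacing every occurrence of the $i$-th smallest positive letter by $i$ for all $i$ (the letters $-1$ unchanged). $\mathcal{D}_n^1$ is the set of all such words for $\pi\in\mathfrak{S}_n$ (the derangement forms of $1$-arrangements of $[n]$). For an integer word $w$, $\mathrm{red}(w)$ is obtained by replacing every occurrence of the $i$-th smallest letter of $w$ by $i$, for all $i$. A word $w=w_1\cdots w_n$ avoids a pattern $\sigma\in\mathfrak{S}_j$ if there are no indices $i_1<\cdots<i_j$ with $\mathrm{red}(w_{i_1}\cdots w_{i_j})=\sigma$. $\mathcal{D}_n^1(\sigma)$ is the set of words in $\mathcal{D}_n^1$ avoiding $\sigma$. *)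

(* Defs.v *)
From mathcomp Require Import all_boot all_order all_algebra all_fingroup.
Set Implicit Arguments. Unset Strict Implicit. Unset Printing Implicit Defensive.
Import Order.TTheory GRing.Theory Num.Theory.
Local Open Scope ring_scope.

Definition red (w : seq int) : seq nat :=
  [seq (size (undup [seq b <- w | b < a])).+1 | a <- w].

Definition posred (w : seq int) : seq int :=
  [seq if 0 < a then ((size (undup [seq b <- w | (0 < b) && (b < a)])).+1)%:Z else a
  | a <- w].

(* The word of pi in S_n: pi(1)...pi(n) (values 1..n), fixed points replaced by -1,
   then positive letters reduced.  'I_n is {0,..,n-1}; the value of position i is (pi i).+1. *)
Definition dword (n : nat) (pi : 'S_n) : seq int :=
  posred [seq if pi i == i then (-1) else ((pi i : nat).+1)%:Z | i <- enum 'I_n].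

Definition Dn1 (n : nat) : seq (seq int) := undup [seq dword pi | pi <- enum [set: 'S_n]].

Definition avoids (w : seq int) (sigma : seq nat) : bool :=
  [forall m : (size w).-tuple bool, red (mask m w) != sigma].

Definition Dcount (n : nat) (sigma : seq nat) : nat :=
  count (fun w => avoids w sigma) (Dn1 n).

Definition p321 : seq nat := [:: 3; 2; 1]%N.
Definition p132 : seq nat := [:: 1; 3; 2]%N.

Definition a321 (n : nat) : nat := if n == 0%N then 1%N else Dcount n p321.

(* Main.v *)
(** Write a blank [0] for the letter [-1], and consider all words whose positive letters form
    a permutation of [1..k], deranged or not.  Let [s n] and [c n] count those of length [n]
    that avoid the pattern, with and without blanks, and [a n] those without fixed points.
    Cutting a word at a suitable fixed point (the first one for 321, the outermost node of a
    binary tree for 132) gives, for both patterns,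
    [s n + sum_(i<n) c i = a n + sum_(i<n) a i * c (n-1-i) + sum_(i<n) s i].
    For both patterns [c] is the Catalan sequence and [s n = c (n+1)]: 132-avoiding words are
    binary trees, and removing the first letter of a 321-avoiding word yields the ballot
    recursion.  Hence the two sequences [a] agree, and
    [a n + sum_(i<n) a i * c (n-1-i) + c n = c (n+1) + 1] becomes, with [C = 1 + x C^2],
    the equation [A (1 + x C) = C^2 - C + 1/(1-x)] between generating functions. *)

Require Import Defs.
From HB Require Import structures.

(* Modules confine the mathcomp notations, so that [<=] in the theorem is that of [nat]. *)
Module Combinatorics.
From mathcomp Require Import all_boot all_order all_algebra all_fingroup zify.
Set Implicit Arguments. Unset Strict Implicit. Unset Printing Implicit Defensive.

(** * Words with blanks *)

(** The sums without a factor [a i] in the identity come from words of blanks. When a word is cut at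
    a fixed point, one piece is free of fixed points, and the other may contain blanks only if the
    first has no positive letter. There is one such all-blank word of each length [i]; it
    contributes [s (n-1-i)], while each of the other [a i - 1] words contributes [c (n-1-i)]. Both
    patterns obey the same restriction, so the counts agree although the two cuts are unrelated.

    Positions are counted among positive letters only. Deleting the fixed points of a permutation
    relabels positions and values by the same increasing map, so the derangement forms are exactly
    the reduced words without fixed points.

    The analytic obstacles are convergence up to [1/4] and the branch of the square root. One bound
    settles both: the Catalan series is at most 2 there, proved from the recurrence alone. *)

Definition pos (w : seq nat) := [seq x <- w | 0 < x].
Definition reduced (w : seq nat) := perm_eq (pos w) (iota 1 (size (pos w))).
(** The order in [sorted] is weak because blanks repeat, and an occurrence of a pattern has distinct
    letters. *)
Fixpoint av321 (w : seq nat) :=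
  if w is x :: u then sorted leq [seq y <- u | y < x] && av321 u else true.
Fixpoint av132 (w : seq nat) :=
  if w is x :: u then sorted leq [seq y <- u | x < y] && av132 u else true.
(* For some [p], the [p]-th positive letter of [w], counted from 1, is [p + d]; a fixed point
   when [d = 0]. *)
Fixpoint offset (d : int) (w : seq nat) :=
  if w is x :: u then
    if x == 0 then offset d u else (x%:Z == d + 1)%R || offset (d + 1)%R u
  else false.

Lemma sorted_leqP (s : seq nat) :
  reflect (forall y z, subseq [:: y; z] s -> y <= z) (sorted leq s).
Proof.
apply: (iffP idP) => [ss y z sub|].
  by have := subseq_sorted leq_trans sub ss; rewrite /= andbT.
elim: s => [//|x s IHs] H.
rewrite /= path_sortedE; last exact: leq_trans.
apply/andP; split.
  by apply/allP => y ys; apply: H; rewrite /= eqxx sub1seq.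
by apply: IHs => y z sub; apply: H; apply: (subseq_trans sub); apply: subseq_cons.
Qed.

Lemma subseq3_cons (a b c x : nat) u :
  subseq [:: a; b; c] (x :: u) =
  (a == x) && subseq [:: b; c] u || subseq [:: a; b; c] u.
Proof.
rewrite /=; case: eqP => //= _.
by apply/idP/idP => [->//|/orP[//|]]; apply: subseq_trans; apply: subseq_cons.
Qed.

Lemma av321P w :
  reflect (forall x y z, subseq [:: x; y; z] w -> y < x -> y <= z) (av321 w).
Proof.
elim: w => [|x u IHu]; first by apply: ReflectT.
rewrite [av321 _]/=.
apply: (iffP andP) => [[/sorted_leqP su /IHu au] a b c|H].
  rewrite subseq3_cons => /orP[/andP[/eqP-> bc]|].
    move=> bx; rewrite leqNgt; apply/negP => cb; have cx := ltn_trans cb bx.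
    have := su b c; rewrite subseq_filter /= bx cx => /(_ bc); lia.
  exact: au.
split.
  apply/sorted_leqP => b c; rewrite subseq_filter /= => /andP[/and3P[bx cx _] sub].
  by apply: (H x b c) => //; rewrite subseq3_cons eqxx sub.
apply/IHu => a b c sub; apply: (H a b c).
by rewrite subseq3_cons sub orbT.
Qed.

Lemma av132P w :
  reflect (forall x y z, subseq [:: x; y; z] w -> x < z -> y <= z) (av132 w).
Proof.
elim: w => [|x u IHu]; first by apply: ReflectT.
rewrite [av132 _]/=.
apply: (iffP andP) => [[/sorted_leqP su /IHu au] a b c|H].
  rewrite subseq3_cons => /orP[/andP[/eqP-> bc]|].
    move=> cx; rewrite leqNgt; apply/negP => cb; have bx := ltn_trans cx cb.
    have := su b c; rewrite subseq_filter /= bx cx => /(_ bc); lia.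
  exact: au.
split.
  apply/sorted_leqP => b c; rewrite subseq_filter /= => /andP[/and3P[bx cx _] sub].
  by apply: (H x b c) => //; rewrite subseq3_cons eqxx sub.
apply/IHu => a b c sub; apply: (H a b c).
by rewrite subseq3_cons sub orbT.
Qed.

Lemma size_pos w : size (pos w) + count_mem 0 w = size w.
Proof.
by elim: w => //= x u; case: x => [|x] /=; lia.
Qed.

Lemma pos_cat u v : pos (u ++ v) = pos u ++ pos v.
Proof. exact: filter_cat. Qed.

Lemma reducedP w :
  reflect (uniq (pos w) /\ forall x, (x \in w) && (0 < x) = (0 < x <= size (pos w)))
          (reduced w).
Proof.
apply: (iffP idP) => [rw|[uw mw]].
  split; first by rewrite (perm_uniq rw) iota_uniq.
  by move=> x; move: (perm_mem rw x); rewrite mem_filter mem_iota; lia.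
apply: uniq_perm => //; first exact: iota_uniq.
by move=> x; rewrite mem_filter mem_iota; have := mw x; lia.
Qed.

Lemma offset_pos d w : offset d (pos w) = offset d w.
Proof.
elim: w d => //= x u IHu d; case: x => [|x] //=; by rewrite IHu.
Qed.

Lemma offset_cat d u v :
  offset d (u ++ v) = offset d u || offset (d + (size (pos u))%:Z)%R v.
Proof.
elim: u d => [|x u IHu] d /=; first by rewrite GRing.addr0.
case: x => [|x] //=; rewrite IHu orbA; congr (_ || offset _ _); lia.
Qed.

Lemma offset_first d w : offset d w ->
  exists u x v, [/\ w = u ++ x :: v, 0 < x, (x%:Z = d + 1 + (size (pos u))%:Z)%R
                 & ~~ offset d u].
Proof.
elim/last_ind: w => // w x IHw.
rewrite -cats1 offset_cat; case: (boolP (offset d w)) => [/IHw [u [y [v [-> y0 yE nu]]]] _|nw].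
  by exists u, y, (v ++ [:: x]); rewrite -catA.
by case: x => //= x /orP[/eqP xE|//]; exists w, x.+1, [::]; split => //; lia.
Qed.

Lemma offset_first_inj d u x v u' x' v' :
  0 < x -> (x%:Z = d + 1 + (size (pos u))%:Z)%R -> ~~ offset d u ->
  0 < x' -> (x'%:Z = d + 1 + (size (pos u'))%:Z)%R -> ~~ offset d u' ->
  u ++ x :: v = u' ++ x' :: v' -> [/\ u = u', x = x' & v = v'].
Proof.
wlog le_uu : u x v u' x' v' / size u <= size u' => [H|].
  move=> *; case: (leqP (size u) (size u')) => le; first exact: (H).
  by case: (H u' x' v' u x v) => //; apply: ltnW.
move=> x0 xE nu x0' xE' nu' e.
have [eq_s|ne_s] := eqVneq (size u) (size u').
  by move/eqP: e; rewrite eqseq_cat // => /andP[/eqP-> /eqP[-> ->]].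
have lt_s : size u < size u' by lia.
suff : offset d u' by rewrite (negbTE nu').
have -> : u' = u ++ x :: take (size u' - (size u).+1) v.
  have uE : take (size u') (u ++ x :: v) = u' by rewrite e take_size_cat.
  rewrite -[LHS]uE take_cat ltnNge le_uu /=; congr (_ ++ _).
  by rewrite -(subnSK lt_s).
rewrite offset_cat /=; case: (x) x0 xE => // y _ yE /=.
by apply/orP; right; apply/orP; left; apply/eqP; lia.
Qed.

(* [lst n] lists the words of length [n]; those with a fixed point are the [glue x y] with [x]
   fixed-point free, where [y] may contain blanks only if [x] is [triv], that is, made of
   blanks. There is one trivial [x] of each length. *)
Lemma renewal (X : eqType) (lst : nat -> seq X) (len : X -> nat)
    (der nob triv : pred X) (glue : X -> X -> X) :
  (forall n, uniq (lst n)) ->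
  (forall n x, x \in lst n -> len x = n) ->
  (forall n, count [pred x | der x & triv x] (lst n) = 1) ->
  (forall x y x' y', x \in lst (len x) -> y \in lst (len y) ->
     x' \in lst (len x') -> y' \in lst (len y') ->
     der x -> nob y || triv x -> der x' -> nob y' || triv x' ->
     glue x y = glue x' y' -> x = x' /\ y = y') ->
  (forall n x y, x \in lst (len x) -> y \in lst (len y) -> (len x + len y).+1 = n ->
     der x -> nob y || triv x -> glue x y \in lst n /\ ~~ der (glue x y)) ->
  (forall n z, z \in lst n -> ~~ der z -> exists x y,
     [/\ x \in lst (len x) /\ y \in lst (len y), (len x + len y).+1 = n,
         der x, nob y || triv x & z = glue x y]) ->
  forall n,
  size (lst n) + \sum_(i < n) count nob (lst (n.-1 - i)) =
  count der (lst n) + \sum_(i < n) count der (lst i) * count nob (lst (n.-1 - i))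
   + \sum_(i < n) size (lst (n.-1 - i)).
Proof.
move=> ul lenl ctriv ginj gin gsurj n.
pose s := [seq x <- flatten [seq lst i | i <- iota 0 n] | der x].
pose t x := [seq y <- lst (n.-1 - len x) | nob y || triv x].
have memflat x k : (x \in flatten [seq lst i | i <- iota 0 k]) = (len x < k) && (x \in lst (len x)).
  apply/flattenP/andP => [[l /mapP[i]]|[lx xl]].
    by rewrite mem_iota => /andP[_ ik] -> xl; rewrite (lenl _ _ xl) xl.
  by exists (lst (len x)) => //; apply: map_f; rewrite mem_iota.
have mems x : (x \in s) = [&& der x, len x < n & x \in lst (len x)].
  by rewrite mem_filter memflat.
have memt x y : (y \in t x) -> [/\ nob y || triv x, y \in lst (len y) & len y = n.-1 - len x].
  by rewrite mem_filter => /andP[-> yl]; rewrite {2}(lenl _ _ yl) (lenl _ _ yl).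
have us : uniq s.
  apply: filter_uniq; rewrite /s; move: (n) => k.
  elim: k => // k IHk; rewrite -addn1 iotaD map_cat flatten_cat /= cats0 cat_uniq IHk ul andbT.
  apply/hasPn => x xk; rewrite memflat; rewrite add0n in xk; have := lenl _ _ xk.
  by move=> ->; rewrite ltnn.
have E : perm_eq [seq x <- lst n | ~~ der x] [seq glue x y | x <- s, y <- t x].
  apply: uniq_perm; first exact: filter_uniq.
    apply: allpairs_uniq_dep => //; first by move=> x _; apply: filter_uniq.
    move=> /= _ _ /allpairsPdep[x [y [xs yt ->]]] /allpairsPdep[x' [y' [xs' yt' ->]]] /= e.
    move: xs xs'; rewrite !mems => /and3P[dx lx xl] /and3P[dx' lx' xl'].
    have [ny yl ly] := memt _ _ yt; have [ny' yl' ly'] := memt _ _ yt'.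
    by have [-> ->] := ginj _ _ _ _ xl yl xl' yl' dx ny dx' ny' e.
  move=> z; rewrite mem_filter; apply/andP/allpairsPdep => [[ndz zl]|[x [y [xs yt ->]]]].
    have [x [y [[xl yl] le dx ny ->]]] := gsurj _ _ zl ndz.
    exists x, y; split => //; first by rewrite mems dx xl andbT; lia.
    by rewrite mem_filter ny; have -> : n.-1 - len x = len y by lia.
  move: xs; rewrite mems => /and3P[dx lx xl]; have [ny yl ly] := memt _ _ yt.
  by have [] := gin n x y xl yl _ dx ny => //; lia.
have {E} : size (lst n) = count der (lst n) + sumn [seq size (t x) | x <- s].
  by rewrite -(count_predC der) -[count (predC der) _]size_filter (perm_size E) size_allpairs_dep.
move=> ->; rewrite -!addnA; congr (_ + _).
pose cn i := count nob (lst (n.-1 - i)).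
pose sn i := size (lst (n.-1 - i)).
(* The trivial [x] of length [i] has [sn i] partners, all others have [cn i]. The term [cn i] on the
   left stands for a subtraction on the right. *)
have part i : i < n -> 
   sumn [seq size (t x) | x <- [seq x <- lst i | der x]] + cn i
     = count der (lst i) * cn i + sn i.
  move=> lin.
  have : sumn [seq size (t x) | x <- [seq x <- lst i | der x]] +
     count triv [seq x <- lst i | der x] * cn i =
     size [seq x <- lst i | der x] * cn i + count triv [seq x <- lst i | der x] * sn i.
    have : {subset [seq x <- lst i | der x] <= lst i} by apply: mem_subseq; apply: filter_subseq.
    elim: [seq x <- lst i | der x] => //= x l IHl sub.
    have -> : size (t x) = if triv x then sn i else cn i.
      rewrite /t (lenl i x (sub x (mem_head _ _))) /sn /cn size_filter.
      case: (triv x); first by rewrite (eq_count (a2 := predT)) ?count_predT // => y; rewrite /= orbT.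
      by apply: eq_count => y; rewrite /= orbF.
    have := IHl (fun y yl => sub y (mem_behead (s := x :: l) yl)).
    by case: (triv x) => /=; nia.
  rewrite count_filter (eq_count (a2 := [pred x | der x & triv x])) ?ctriv; last by move=> x /=; rewrite andbC.
  by rewrite size_filter !mul1n.
have flat : forall k, k <= n ->
   sumn [seq size (t x) | x <- [seq x <- flatten [seq lst i | i <- iota 0 k] | der x]]
   + \sum_(i < k) cn i = \sum_(i < k) count der (lst i) * cn i + \sum_(i < k) sn i.
  elim=> [|k IHk] lk; first by rewrite !big_ord0.
  rewrite -addn1 iotaD map_cat flatten_cat /= cats0 filter_cat map_cat sumn_cat addn1.
  rewrite !big_ord_recr /= add0n.
  by rewrite addnACA (IHk (ltnW lk)) part // addnACA.
exact: flat.
Qed.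

(** * 132-avoiding words as binary trees *)

(* [Node s t] codes the word [(s + v) t v], where [v] exceeds by one the number of positive
   letters of [t]: in a 132-avoiding word ending in [v], the letters above [v] precede those
   below. Only [t] may contain blanks, a blank being below [v]; see [ok]. *)
Inductive tree := Leaf | Blank of tree | Node of tree & tree.

Lemma tree_comparable : comparable tree.
Proof. by move=> s t; rewrite /decidable; decide equality. Defined.
HB.instance Definition _ := hasDecEq.Build tree (compareP tree_comparable).

Fixpoint sz t := match t with
  Leaf => 0 | Blank t => sz t | Node s t => (sz s + sz t).+1 end.
Fixpoint len t := match t with
  Leaf => 0 | Blank t => (len t).+1 | Node s t => (len s + len t).+1 end.
Fixpoint nob t := match t with
  Leaf => true | Blank _ => false | Node s t => nob s && nob t end.
Fixpoint ok t := match t with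
  Leaf => true | Blank t => ok t | Node s t => nob s && ok t end.
Fixpoint word t := match t with
  Leaf => [::] | Blank t => rcons (word t) 0
  | Node s t => [seq x + (sz t).+1 | x <- word s] ++ rcons (word t) (sz t).+1 end.

(** * Cutting and gluing trees at a node of given offset *)

Section Offsets.
Local Open Scope ring_scope.

(* The last letter of [Node s t] has offset minus the size of [s], see [offset_word]. *)
Fixpoint has_at (d : int) t := match t with
  | Leaf => false
  | Blank t => has_at d t
  | Node s t => [|| d == - (sz s)%:Z, has_at (d - (sz t)%:Z - 1) s
                                   | has_at (d + (sz s)%:Z) t]
  end.

(* Removes the outermost node of offset [d] and its right subtree. If the root is not that node,
   [d] is realised in at most one subtree, which the test on the sizes selects. *)
Fixpoint cut (d : int) t : option (tree * tree) := match t with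
  | Leaf => None
  | Blank t => if cut d t is Some (b, t') then Some (b, Blank t') else None
  | Node s t =>
    if d == - (sz s)%:Z then Some (t, s)
    else if (sz t)%:Z + 1 - (sz s)%:Z <= d then
      if cut (d - (sz t)%:Z - 1) s is Some (b, s') then Some (b, Node s' t) else None
    else if cut (d + (sz s)%:Z) t is Some (b, t') then Some (b, Node s t') else None
  end.

(** Inverse of [cut]: inserts a node of offset [d] with right subtree [b]. For [Node s t'] of size
    [k], the interval from [-k] to [k] splits without gap or overlap into [-k], where the whole tree
    becomes a left subtree, then [2 * sz t' + 1] values passed on to [t'], then [2 * sz s + 1]
    values passed on to [s]. This dictates the threshold. A blank is passed over, since left
    subtrees may not contain any. *)
Fixpoint glue (d : int) b t := match t with
  | Leaf => Node Leaf b
  | Blank t => Blank (glue d b t)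
  | Node s t' =>
    if d == - (sz t)%:Z then Node t b
    else if (sz t')%:Z + 1 - (sz s)%:Z <= d then Node (glue (d - (sz t')%:Z - 1) b s) t'
    else Node s (glue (d + (sz s)%:Z) b t')
  end.

Lemma nob_ok t : nob t -> ok t.
Proof. by elim: t => //= s _ t IHt /andP[-> /IHt]. Qed.

Lemma nob_sz t : nob t -> sz t = len t.
Proof. by elim: t => //= s IHs t IHt /andP[/IHs -> /IHt ->]. Qed.

Lemma has_at_range d t : has_at d t -> (- (sz t)%:Z < d < (sz t)%:Z).
Proof.
elim: t d => //= s IHs t IHt d /or3P[/eqP->|/IHs|/IHt]; lia.
Qed.

Lemma sz_glue d b t : sz (glue d b t) = (sz b + sz t).+1.
Proof.
elim: t d => //= [|s IHs t IHt] d; first by rewrite add0n addn0.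
by case: ifP => _ /=; [lia|case: ifP => _ /=; rewrite ?IHs ?IHt; lia].
Qed.

Lemma len_glue d b t : len (glue d b t) = (len b + len t).+1.
Proof.
elim: t d => //= [|t IHt|s IHs t IHt] d; first by rewrite add0n addn0.
  by rewrite IHt; lia.
by case: ifP => _ /=; [lia|case: ifP => _ /=; rewrite ?IHs ?IHt; lia].
Qed.

Lemma has_at_glue d b t : - (sz t)%:Z <= d <= (sz t)%:Z -> has_at d (glue d b t).
Proof.
elim: t d => [|t IHt|s IHs t IHt] d /=.
- by move=> ?; apply/orP; left; apply/eqP; lia.
- exact: IHt.
move=> dr; case: ifP => [/eqP-> /=|/eqP dn]; first by rewrite eqxx.
case: ifP => dt /=.
  by rewrite IHs ?orbT //; lia.
by rewrite IHt ?orbT //; lia.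
Qed.

(** The offset must be new to [t]: a node above the insertion that already had offset [d] could be
    cut first. *)
Lemma cut_glue d b t : - (sz t)%:Z <= d <= (sz t)%:Z -> ~~ has_at d t ->
  cut d (glue d b t) = Some (b, t).
Proof.
elim: t d => [|t IHt|s IHs t IHt] d /=.
- by move=> ? _; case: eqP => //; lia.
- by move=> dr nh; rewrite IHt.
move=> dr /norP[/eqP ds /norP[ns nt]].
case: ifP => [/eqP-> /=|/eqP dn]; first by rewrite eqxx.
case: ifP => dt /=.
  rewrite sz_glue; case: eqP => [|_]; first lia.
  have -> : (sz t)%:Z + 1 - (sz b + sz s).+1%:Z <= d by lia.
  by rewrite IHs //; lia.
case: eqP => // _; rewrite sz_glue.
have -> : ((sz b + sz t).+1%:Z + 1 - (sz s)%:Z <= d) = false by lia.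
by rewrite IHt //; lia.
Qed.

(** Removing the right subtree along with the node is what makes [d] disappear. If the root of
    [Node s t] has offset [- sz s], all offsets within the remaining tree [s] are larger, so any
    further occurrence of [d] lies in [t]. *)
Lemma glue_cut d t : ok t -> has_at d t -> exists b t',
  [/\ cut d t = Some (b, t'), glue d b t' = t, ~~ has_at d t',
      - (sz t')%:Z <= d <= (sz t')%:Z & (nob t -> nob b && nob t') /\ ok b /\ ok t'].
Proof.
elim: t d => [|t IHt|s IHs t IHt] d //=.
  move=> okt /(IHt _ okt)[b [t' [-> gE nh dr [nbt [okb okt']]]]].
  by exists b, (Blank t'); split => //=; rewrite gE.
case/andP => ns okt; case: eqP => [-> _|ds].
  exists t, s; split => //; last first.
  - by split; [move=> /andP[-> ->]|split => //; apply: nob_ok].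
  - by lia.
  - by apply/negP => /has_at_range; lia.
  - by case: s ns {IHs} => //= s1 s2 _; rewrite eqxx.
rewrite /=; case: ifP => dt.
  move=> h; have /(IHs _ (nob_ok ns))[b [s' [cE gE nh dr [nbt [okb okt']]]]] :
      has_at (d - (sz t)%:Z - 1) s.
    by case/orP: h => // /has_at_range; lia.
  have /andP[nb ns'] := nbt ns; have szs : sz s = (sz b + sz s').+1 by rewrite -gE sz_glue.
  exists b, (Node s' t); rewrite cE; split => //=.
  - case: eqP => [|_]; first lia.
    by case: ifP => [|]; [rewrite gE|lia].
  - rewrite negb_or negb_or nh /=; apply/andP; split; first by apply/eqP; lia.
    by apply/negP => /has_at_range; lia.
  - by lia.
  - by split; [rewrite nb ns' => /andP[_ ->]|rewrite ns'].
move=> h; have /(IHt _ okt)[b [t' [cE gE nh dr [nbt [okb okt']]]]] :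
    has_at (d + (sz s)%:Z) t.
  by case/orP: h => // /has_at_range; lia.
have szt : sz t = (sz b + sz t').+1 by rewrite -gE sz_glue.
exists b, (Node s t'); rewrite cE; split => //=.
- case: eqP => [|_]; first lia.
  by case: ifP => [|]; [lia|rewrite gE].
- rewrite negb_or negb_or nh andbT /=; apply/andP; split; first exact/eqP.
  by apply/negP => /has_at_range; lia.
- by lia.
- by split; [case/andP => -> /nbt/andP[-> ->]|rewrite ns].
Qed.

Lemma cut_has_at d t p : cut d t = Some p -> has_at d t.
Proof.
elim: t d p => //= [t IHt|s IHs t IHt] d p.
  by case E: (cut d t) => [p'|] // _; apply: IHt E.
case: eqP => //= _; case: ifP => _; case E: (cut _ _) => [p'|] // _.
  by rewrite (IHs _ _ E).
by rewrite (IHt _ _ E) orbT.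
Qed.

(** A root of offset [d >= 0] forces [d = 0] and a left subtree of size 0. A descent to the left
    stays in a blank-free tree. A descent to the right replaces [d] by [d + sz s]; if this is 0,
    then [d = - sz s] and the root itself would have been cut. *)
Lemma cut_nob d b t t' : ok t -> 0 <= d -> cut d t = Some (b, t') ->
  nob b || (d == 0) && (sz t' == 0)%N.
Proof.
elim: t d b t' => [|t IHt|s IHs t IHt] d b t' //=.
  move=> okt d0; case E : (cut d t) => [[b1 t1]|] // [<- <-].
  exact: IHt E.
case/andP => ns okt d0; case: eqP => [ds|ds].
  by move=> [_ <-]; apply/orP; right; apply/andP; split; lia.
case: ifP => _.
  case E : (cut _ s) => [[b1 t1]|] // [<- _].
  have hs := cut_has_at E.
  have [b2 [t2 [E2 _ _ _ [nbt _]]]] := glue_cut (nob_ok ns) hs.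
  by move: E2 nbt; rewrite E => -[<- _] /(_ ns)/andP[->].
case E : (cut _ t) => [[b1 t1]|] // [<- _].
have := IHt _ _ _ okt _ E; case: (nob b1) => //= H.
by have /andP[] := H ltac:(lia); lia.
Qed.

Lemma nob_glue d b t : nob t -> nob b -> nob (glue d b t).
Proof.
move=> + nb; elim: t d => [|t IHt|s IHs t IHt] d //=.
case/andP => ns nt; case: ifP => _ /=; first by rewrite ns nt.
by case: ifP => _ /=; rewrite ?IHs ?IHt ?ns ?nt.
Qed.

(** A [Node] becomes a left subtree only when the offset is minus its size. For [d >= 0] this
    happens only inside left subtrees, where there are no blanks anyway. *)
Lemma ok_glue d b t : ok t -> nob b -> 0 <= d -> ok (glue d b t).
Proof.
move=> + nb; elim: t d => [|t IHt|s IHs t IHt] d //=; [by rewrite nob_ok|exact: IHt|].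
case/andP => ns okt d0; case: eqP => [|_]; first lia.
case: ifP => _ /=; first by rewrite nob_glue.
by rewrite ns IHt //; lia.
Qed.

Lemma ok_glue0 b t : ok t -> ok b -> sz t = 0%N -> ok (glue 0 b t).
Proof. by move=> + okb; elim: t. Qed.

Lemma offset_map d v w : all (fun x => 0 < x)%N w ->
  offset d [seq (x + v)%N | x <- w] = offset (d - v%:Z) w.
Proof.
elim: w d => //= x w IHw d /andP[x0 aw].
have -> : (x + v == 0)%N = false by lia.
have -> : (x == 0)%N = false by lia.
by rewrite IHw //; congr (_ || offset _ _); [apply/eqP/eqP; lia|lia].
Qed.

End Offsets.

(** * The code between trees and 132-avoiding words *)

Lemma size_word t : size (word t) = len t.
Proof.
by elim: t => //= [t IHt|s IHs t IHt]; rewrite ?size_cat ?size_rcons ?size_map ?IHs ?IHt //; lia.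
Qed.

Lemma nob_word t : nob t -> all (fun x => 0 < x) (word t).
Proof.
elim: t => //= s IHs t IHt /andP[/IHs as_ /IHt at_].
rewrite all_cat all_rcons /= at_ andbT all_map.
by apply: sub_all as_ => x /=; lia.
Qed.

Lemma ok_nob t : ok t -> nob t = (0 \notin word t).
Proof.
elim: t => //= [t _ _|s IHs t IHt /andP[ns okt]]; first by rewrite mem_rcons mem_head.
rewrite mem_cat mem_rcons inE /= ns IHt //; congr (~~ _).
by case: mapP => // -[x _]; lia.
Qed.

Lemma pos_all w : all (fun x => 0 < x) w -> pos w = w.
Proof. by move/all_filterP. Qed.

Lemma pos_rcons w x : pos (rcons w x) = if 0 < x then rcons (pos w) x else pos w.
Proof. exact: filter_rcons. Qed.

Lemma pos_word_Node s t : nob s ->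
  pos (word (Node s t)) = [seq x + (sz t).+1 | x <- word s] ++ rcons (pos (word t)) (sz t).+1.
Proof.
move=> /nob_word ns; rewrite /= pos_cat pos_rcons /= pos_all //.
by rewrite all_map; apply: sub_all ns => x /=; lia.
Qed.

Lemma size_pos_word t : ok t -> size (pos (word t)) = sz t.
Proof.
elim: t => //= [t IHt|s IHs t IHt]; first by rewrite pos_rcons.
case/andP => ns okt; rewrite -/(word (Node s t)) pos_word_Node //.
by rewrite size_cat size_map size_rcons IHt // size_word -nob_sz //; lia.
Qed.

Lemma offset_word d t : ok t -> offset d (word t) = has_at d t.
Proof.
elim: t d => //= [t IHt|s IHs t IHt] d.
  by move=> okt; rewrite -cats1 offset_cat /= orbF IHt.
case/andP => ns okt; rewrite offset_cat offset_map ?nob_word // -cats1 offset_cat /= orbF.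
rewrite IHs ?nob_ok // IHt // size_pos_word // pos_all; last first.
  by rewrite all_map; apply: sub_all (nob_word ns) => x /=; lia.
rewrite size_map size_word -nob_sz // orbA orbC.
have -> : (d - (sz t).+1%:Z = d - (sz t)%:Z - 1)%R by lia.
by congr (_ || _); apply/eqP/eqP; lia.
Qed.

Lemma word_le t : ok t -> all (fun x => x <= sz t) (word t).
Proof.
elim: t => //= [t IHt okt|s IHs t IHt /andP[ns okt]]; first by rewrite all_rcons IHt.
rewrite all_cat all_rcons all_map; apply/and3P; split; last 2 first.
- by lia.
- by apply: sub_all (IHt okt) => x /=; lia.
- by apply: sub_all (IHs (nob_ok ns)) => x /=; lia.
Qed.

(** With [filter_word_lt], this recovers both subtrees from the word by comparison with its last
    letter, whence [word_inj]. *)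
Lemma filter_word_gt s t : nob s -> ok t ->
  [seq x <- word (Node s t) | (sz t).+1 < x] = [seq x + (sz t).+1 | x <- word s].
Proof.
move=> ns okt; rewrite /= filter_cat filter_rcons ltnn.
rewrite [X in _ ++ X](_ : _ = [::]).
  rewrite cats0; apply/all_filterP; rewrite all_map.
  by apply: sub_all (nob_word ns) => x /=; lia.
apply/eqP; rewrite -(negbK (_ == _)) -has_filter; apply/hasPn => x xt.
by have /allP/(_ x xt) := word_le okt; lia.
Qed.

Lemma filter_word_lt s t : nob s -> ok t ->
  [seq x <- word (Node s t) | x < (sz t).+1] = word t.
Proof.
move=> ns okt; rewrite /= filter_cat filter_rcons ltnn.
rewrite [X in X ++ _](_ : _ = [::]).
  by apply/all_filterP; apply: sub_all (word_le okt) => x /=; lia.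
apply/eqP; rewrite -(negbK (_ == _)) -has_filter; apply/hasPn => x /mapP[y _]; lia.
Qed.

Lemma word_inj s t : ok s -> ok t -> word s = word t -> s = t.
Proof.
elim: s t => [|s IHs|s1 IH1 s2 IH2] [|t|t1 t2] //;
  try by move=> _ _ /(congr1 size); rewrite !size_word.
- by move=> /= oks okt /rcons_inj[/(IHs _ oks okt)->].
- by move=> /= _ _ /(congr1 (last 1)); rewrite last_cat !last_rcons.
- by move=> /= _ _ /(congr1 (last 1)); rewrite last_cat !last_rcons.
move=> oks okt e; have /andP[ns1 oks2] : nob s1 && ok s2 := oks.
have /andP[nt1 okt2] : nob t1 && ok t2 := okt.
have [ev] : (sz s2).+1 = (sz t2).+1.
  by have := congr1 (last 1) e; rewrite /= !last_cat !last_rcons.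
congr Node.
  have := filter_word_gt ns1 oks2; rewrite e ev (filter_word_gt nt1 okt2).
  move/(inj_map (@addIn (sz t2).+1)) => e1; apply: IH1; rewrite ?nob_ok //.
have := filter_word_lt ns1 oks2; rewrite e ev (filter_word_lt nt1 okt2) => e2.
exact: IH2.
Qed.

Lemma perm_reduced w k : perm_eq (pos w) (iota 1 k) -> reduced w.
Proof. by move=> p; rewrite /reduced (perm_size p) size_iota. Qed.

Lemma iota_cut k v : v < k -> perm_eq (iota 1 k)
  ([seq x + v.+1 | x <- iota 1 (k - v.+1)] ++ rcons (iota 1 v) v.+1).
Proof.
move=> vk; rewrite perm_sym perm_catC.
have -> : rcons (iota 1 v) v.+1 = iota 1 v.+1 by rewrite -(addn1 v) iotaD -cats1 addnC.
have -> : [seq x + v.+1 | x <- iota 1 (k - v.+1)] = iota (1 + v.+1) (k - v.+1).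
  by rewrite addnC iotaDl; apply: eq_map => x; rewrite addnC.
by rewrite -iotaD subnKC.
Qed.

Lemma reduced_word t : ok t -> reduced (word t).
Proof.
move=> okt; rewrite /reduced size_pos_word //.
elim: t okt => [//|t IHt|s IHs t IHt] okt; first by rewrite /= pos_rcons IHt.
have /andP[ns okt'] : nob s && ok t := okt; rewrite pos_word_Node // perm_sym /=.
apply: (perm_trans (@iota_cut (sz s + sz t).+1 (sz t) _)); first lia.
apply: perm_cat.
  apply: perm_map; rewrite perm_sym -[word s]pos_all ?nob_word //.
  have -> : (sz s + sz t).+1 - (sz t).+1 = sz s by lia.
  exact: IHs (nob_ok ns).
by rewrite -!cats1 perm_cat2r perm_sym IHt.
Qed.

Lemma av132_addn w v : av132 [seq x + v | x <- w] = av132 w.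
Proof.
elim: w => //= x u ->; rewrite filter_map sorted_map; congr (_ && _).
rewrite (eq_filter (a2 := fun y => x < y)); last by move=> y /=; lia.
by rewrite (eq_sorted (e' := leq)) // => y z /=; lia.
Qed.

(** A final letter can only be the [2] of a pattern 132, and that needs a larger letter before
    it. *)
Lemma av132_rcons_ge w v : all (fun x => x <= v) w -> av132 (rcons w v) = av132 w.
Proof.
elim: w => //= x u IHu /andP[xv au]; rewrite IHu // filter_rcons; congr (_ && _).
case: ifP => // xv'; rewrite -cats1.
have: all (fun y => y <= v) [seq y <- u | x < y].
  by apply/allP => y; rewrite mem_filter => /andP[_ /(allP au)].
by case: [seq y <- u | x < y] => //= y l /andP[yv lv]; rewrite cat_path /= andbT
   (allP (_ : all (leq^~ v) (y :: l)) _ (mem_last y l)) ?andbT //= yv.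
Qed.

Lemma av132_rcons0 w : av132 (rcons w 0) = av132 w.
Proof. by elim: w => //= x u ->; rewrite filter_rcons. Qed.

Lemma av132_word t : ok t -> av132 (word t).
Proof.
elim: t => //= [t IHt okt|s IHs t IHt /andP[ns okt]]; first by rewrite av132_rcons0 IHt.
have av_t : av132 (rcons (word t) (sz t).+1).
  by rewrite av132_rcons_ge ?IHt //; apply: sub_all (word_le okt) => x /=; lia.
move: (IHs (nob_ok ns)) (nob_word ns); elim: (word s) => //= x u IHu /andP[su au] /andP[x0 pu].
rewrite IHu // andbT filter_cat [X in _ ++ X](_ : _ = [::]).
  rewrite cats0 filter_map sorted_map.
  rewrite (eq_filter (a2 := fun y => x < y)); last by move=> y /=; lia.
  by rewrite (eq_sorted (e' := leq)) // => y z /=; lia.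
apply/eqP; rewrite -(negbK (_ == _)) -has_filter; apply/hasPn => y.
by rewrite mem_rcons inE => /orP[/eqP->|/(allP (word_le okt))]; lia.
Qed.

(** A letter [x < v] followed in [u] by some [y > v] would form the pattern 132 with the final
    [v]. *)
Lemma av132_split u v : v \notin u -> av132 (rcons u v) ->
  u = [seq x <- u | v < x] ++ [seq x <- u | x < v].
Proof.
elim: u => //= x u IHu; rewrite inE negb_or => /andP[xv vu] /andP[su /(IHu vu) uE].
case: (ltngtP v x) xv => //= vx _; first by rewrite -uE.
have ule : all (fun y => y < v) u.
  apply/allP => y yu; rewrite ltn_neqAle; apply/andP; split.
    by apply: contraNneq vu => <-.
  case: (leqP y x) => xy; first lia.
  move: su; rewrite filter_rcons vx -cats1 => /sorted_leqP; apply.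
  rewrite -[[:: y; v]]cat1s cat_subseq // sub1seq mem_filter xy //.
rewrite [X in _ = X ++ _](_ : _ = [::]).
  by congr (_ :: _); apply/esym/all_filterP.
by apply/eqP; rewrite -(negbK (_ == _)) -has_filter; apply/hasPn => y /(allP ule); lia.
Qed.

Lemma av132_subseq u w : subseq u w -> av132 w -> av132 u.
Proof.
by move=> uw /av132P H; apply/av132P => x y z s; apply: H; apply: subseq_trans uw.
Qed.

Lemma pos_filterC p w : pos [seq x <- w | p x] = [seq x <- pos w | p x].
Proof. by rewrite /pos -!filter_predI; apply: eq_filter => x /=; rewrite andbC. Qed.

(** A positive final letter is the root. The letters above it, lowered by its value, code the left
    subtree; those below it, blanks included, code the right one. *)
Lemma word_surj w : reduced w -> av132 w -> exists2 t, ok t & word t = w.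
Proof.
have [n] := ubnP (size w); elim: n w => // n IHn w; case/lastP: w => [|u v] szw rw avw.
  by exists Leaf.
rewrite size_rcons ltnS in szw.
case: v rw avw => [|v] rw avw.
  rewrite /reduced pos_rcons in rw; rewrite av132_rcons0 in avw.
  by have [t okt <-] := IHn u szw rw avw; exists (Blank t).
move: (rw); rewrite /reduced pos_rcons /=; set k := size _ => rw'.
have uv : v.+1 \notin u.
  have := perm_uniq rw'; rewrite iota_uniq rcons_uniq mem_filter /= => /andP[//].
have vk : v < k.
  have := perm_mem rw' v.+1; rewrite mem_rcons mem_head mem_iota; lia.
have uE := av132_split uv avw.
have avu : av132 u by apply: av132_subseq avw; apply: subseq_rcons.
have pu : perm_eq (pos u) ([seq x + v.+1 | x <- iota 1 (k - v.+1)] ++ iota 1 v).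
  have := perm_trans rw' (iota_cut vk).
  by rewrite -!cats1 catA perm_cat2r.
have [t okt tE] : exists2 t, ok t & word t = [seq x <- u | x < v.+1].
  apply: IHn; first by apply: leq_trans szw; rewrite ltnS size_filter count_size.
    apply: (@perm_reduced _ v); rewrite pos_filterC.
    apply: (perm_trans (perm_filter _ pu)); rewrite filter_cat [X in X ++ _](_ : _ = [::]).
      by rewrite (all_filterP _) //; apply/allP => y; rewrite mem_iota; lia.
    by apply/eqP; rewrite -(negbK (_ == _)) -has_filter; apply/hasPn => y /mapP[z _]; lia.
  by apply: av132_subseq avu; apply: filter_subseq.
pose a := [seq x <- u | v.+1 < x].
have aE : [seq x + v.+1 | x <- [seq x - v.+1 | x <- a]] = a.
  rewrite -map_comp map_id_in // => x; rewrite mem_filter => /andP[vx _] /=; lia.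
have posa : all (fun x => 0 < x) [seq x - v.+1 | x <- a].
  rewrite all_map; apply/allP => x; rewrite mem_filter => /andP[vx _] /=; lia.
have [s oks sE] : exists2 s, ok s & word s = [seq x - v.+1 | x <- a].
  apply: IHn; first by apply: leq_trans szw; rewrite ltnS size_map size_filter count_size.
    apply: (@perm_reduced _ (k - v.+1)); rewrite pos_all //.
    apply: (perm_map_inj (@addIn v.+1)); rewrite aE.
    have -> : a = pos a by rewrite pos_all //; apply/allP => x; rewrite mem_filter => /andP[]; lia.
    rewrite pos_filterC; apply: (perm_trans (perm_filter _ pu)).
    rewrite filter_cat [X in _ ++ X](_ : _ = [::]).
      by rewrite cats0 (all_filterP _) //; apply/allP => y /mapP[z]; rewrite mem_iota; lia.
    apply/eqP; rewrite -(negbK (_ == _)) -has_filter; apply/hasPn => y; rewrite mem_iota; lia.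
  by rewrite -(av132_addn _ v.+1) aE; apply: av132_subseq avu; apply: filter_subseq.
have szt : sz t = v.
  rewrite -size_pos_word // tE pos_filterC; rewrite (perm_size (perm_filter _ pu)).
  rewrite filter_cat size_cat !size_filter count_map [X in X + _](_ : _ = 0).
    by rewrite -[RHS](size_iota 1); apply/eqP; rewrite -all_count; apply/allP => x; rewrite mem_iota /=; lia.
  by apply/eqP; rewrite -leqn0 leqNgt -has_count; apply/hasPn => x _ /=; lia.
exists (Node s t).
  by rewrite /= okt andbT ok_nob // sE; apply/negP => /(allP posa).
by rewrite /= szt sE aE tE -rcons_cat -uE.
Qed.

(* In [trees_upto], [f] is fuel for the course-of-values recursion on [n]. *)
Definition nodes (l : nat -> seq tree) n :=
  [seq Node p.2 t | p <- [seq (i, s) | i <- iota 0 n, s <- [seq s <- l i | nob s]],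
                    t <- l (n.-1 - p.1)].

Fixpoint trees_upto f n := match n with
  | 0 => [:: Leaf]
  | n'.+1 => if f is f'.+1 then
      [seq Blank t | t <- trees_upto f' n'] ++
      nodes (trees_upto f') n
    else [::]
  end.
Definition trees n := trees_upto n n.

Lemma mem_trees_upto f n t : n <= f -> (t \in trees_upto f n) = ok t && (len t == n).
Proof.
elim: f n t => [|f IHf] [|n] t //= nf; rewrite ?inE.
- by case: t => [|t|s t] //=; rewrite andbF.
- by case: t => [|t|s t] //=; rewrite andbF.
rewrite mem_cat; apply/orP/andP => [[/mapP[s]|/allpairsPdep[[i s] [t' []]]]|[]].
- by rewrite IHf // => /andP[oks /eqP sn] ->; rewrite /= sn.
- case/allpairsPdep => [j [s' []]]; rewrite mem_iota mem_filter => ji /andP[ns].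
  rewrite IHf; last lia; move=> /andP[_ /eqP sj] [-> ->] /=.
  by rewrite IHf; last lia; move=> /andP[okt' /eqP tE] -> /=; rewrite ns okt'; split => //; lia.
case: t => // [t|s t] /= okt; first by move=> ln; left; apply: map_f; rewrite IHf // okt.
case/andP: okt => ns okt ln; right; apply/allpairsPdep; exists (len s, s), t; split => //.
  apply/allpairsPdep; exists (len s), s; rewrite mem_iota mem_filter ns IHf; last lia.
  by rewrite nob_ok // eqxx; split => //; lia.
by rewrite IHf /=; [rewrite okt; lia|lia].
Qed.

Lemma mem_trees n t : (t \in trees n) = ok t && (len t == n).
Proof. exact: mem_trees_upto. Qed.

Lemma uniq_nodes (l : nat -> seq tree) n :
  (forall i, i < n -> uniq (l i)) -> (forall i t, i < n -> t \in l i -> len t = i) ->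
  uniq (nodes l n).
Proof.
move=> ul ll; apply: allpairs_uniq_dep.
- apply: allpairs_uniq_dep; first exact: iota_uniq.
    by move=> i; rewrite mem_iota => ?; rewrite filter_uniq // ul //; lia.
  by move=> [i x] [j y] _ _ /= [-> ->].
- by move=> _ /allpairsPdep[i [s [+ _ ->]]]; rewrite mem_iota => ? /=; apply: ul; lia.
move=> _ _ /= /allpairsPdep[[i s] [t [+ _ ->]]] /allpairsPdep[[i' s'] [t' [+ _ ->]]] /=.
move=> /allpairsPdep[j [u [ji uj [-> ->]]]] /allpairsPdep[j' [u' [ji' uj' [-> ->]]]] [e1 e2].
move: ji uj ji' uj'; rewrite !mem_iota !mem_filter => ji /andP[_ uj] ji' /andP[_ uj'].
have := ll _ _ ji uj; have := ll _ _ ji' uj'.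
by rewrite e1 e2 => -> ->.
Qed.

Lemma uniq_trees_upto f n : n <= f -> uniq (trees_upto f n).
Proof.
elim: f n => [|f IHf] [|n] //= nf.
rewrite cat_uniq map_inj_uniq ?IHf //=; last by move=> x y [].
apply/andP; split.
  by apply/hasPn => t /allpairsPdep[p [t' [_ _ ->]]]; apply/mapP => -[].
apply: uniq_nodes => i; first by move=> ?; apply: IHf; lia.
by move=> t ilt; rewrite mem_trees_upto; [case/andP => _ /eqP|lia].
Qed.

Lemma perm_trees_upto f n : n <= f -> perm_eq (trees_upto f n) (trees n).
Proof.
move=> nf; apply: uniq_perm; rewrite ?uniq_trees_upto //.
by move=> t; rewrite mem_trees mem_trees_upto.
Qed.

Lemma count_trees_upto f n q : n <= f -> count q (trees_upto f n) = count q (trees n).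
Proof. by move/perm_trees_upto/seq.permP; apply. Qed.

Lemma sumn_map_iota (F : nat -> nat) n : sumn [seq F i | i <- iota 0 n] = \sum_(i < n) F i.
Proof. by rewrite sumnE big_map -[n in iota 0 n]subn0 -/(index_iota 0 n) big_mkord. Qed.

Lemma sum_nodes (l : nat -> seq tree) n (q : pred tree) :
  (forall s t, nob s -> q (Node s t) = q t) ->
  count q (nodes l n) = \sum_(i < n) count nob (l i) * count q (l (n.-1 - i)).
Proof.
move=> qN; rewrite -(sumn_map_iota (fun i => count nob (l i) * count q (l (n.-1 - i)))).
rewrite /nodes; elim: (iota 0 n) => //= i r IHr.
rewrite !map_cat flatten_cat count_cat IHr; congr (_ + _).
rewrite -!map_comp.
elim: (l i) => //= s r' IHr'; case: ifP => //= ns.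
rewrite count_cat IHr' mulnDl mul1n; congr (_ + _).
by rewrite count_map; apply: eq_count => t /=; apply: qN.
Qed.

Lemma size_trees n : size (trees n.+1) =
  size (trees n) + \sum_(i < n.+1) count nob (trees i) * size (trees (n - i)).
Proof.
rewrite -!count_predT count_cat count_map sum_nodes //; congr (_ + _).
apply: eq_bigr => i _; rewrite -!count_predT !count_trees_upto //; first exact: leq_subr.
by rewrite -ltnS.
Qed.

Lemma count_nob_trees n : count nob (trees n.+1) =
  \sum_(i < n.+1) count nob (trees i) * count nob (trees (n - i)).
Proof.
rewrite count_cat sum_nodes; last by move=> s t /= ->.
rewrite count_map (eq_count (a2 := pred0)) // count_pred0 add0n.
apply: eq_bigr => i _; rewrite !count_trees_upto //; first exact: leq_subr.
by rewrite -ltnS.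
Qed.

Lemma iter_Blank t : sz t = 0 -> t = iter (len t) Blank Leaf.
Proof. by elim: t => //= t IHt /IHt {1}->. Qed.

(** In [renewal], [x] is here the tree that survives the cut and [y] the removed right subtree. The
    trees of size 0 are the chains of blanks. *)
Lemma trees_renewal n :
  size (trees n) + \sum_(i < n) count nob (trees (n.-1 - i)) =
  count (predC (has_at 0)) (trees n)
   + \sum_(i < n) count (predC (has_at 0)) (trees i) * count nob (trees (n.-1 - i))
   + \sum_(i < n) size (trees (n.-1 - i)).
Proof.
apply: (@renewal _ trees len _ nob (fun t => sz t == 0) (fun t b => glue 0 b t)).
- by move=> k; apply: uniq_trees_upto.
- by move=> k t; rewrite mem_trees => /andP[_ /eqP].
- move=> k; rewrite (@eq_in_count _ _ (pred1 (iter k Blank Leaf))).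
    rewrite count_uniq_mem ?uniq_trees_upto // mem_trees.
    by rewrite (_ : ok _ && _) //; elim: k => //= k /andP[-> /eqP->]; rewrite eqxx.
  move=> t; rewrite mem_trees => /andP[_ /eqP<-] /=.
  apply/andP/eqP => [[_ /eqP/iter_Blank]//|->].
  by elim: (len t) => //= m [-> /eqP ->].
- move=> t b t' b'; rewrite !mem_trees => /andP[okt _] /andP[okb _] /andP[okt' _] /andP[okb' _].
  move=> dt _ dt' _ e.
  have := cut_glue b (t := t) (d := 0) _ dt; rewrite e cut_glue //; try lia.
  by move=> /(_ ltac:(lia)) [-> ->].
- move=> k t b; rewrite !mem_trees => /andP[okt _] /andP[okb _] ln dt nb.
  rewrite /= len_glue has_at_glue ?andbT; last by lia.
  have -> : (len b + len t).+1 == k by lia.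
  rewrite andbT; split => //; case/orP: nb => [nb|/eqP sz0]; last exact: ok_glue0.
  exact: ok_glue.
move=> k z; rewrite !mem_trees => /andP[okz /eqP lz] /negbNE hz.
have [b [t [cE gE nh dr [_ [okb okt]]]]] := glue_cut okz hz.
exists t, b; rewrite !mem_trees okb okt !eqxx -gE; split => //.
  by rewrite -lz -gE len_glue addnC.
by have := cut_nob okz _ cE; rewrite eqxx /=; apply.
Qed.

(** * 321-avoiding words *)

(* Removing the first letter [v] of a 321-avoiding word turns the smaller letters, which are in
   increasing order, into blanks: [collapse v]. They are restored by [fill v s]. *)
Definition collapse v (u : seq nat) := [seq x - v | x <- u].
Fixpoint fill v s u := match u with
  | [::] => [::]
  | 0 :: u' => head 0 s :: fill v (behead s) u'
  | x :: u' => x + v :: fill v s u'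
  end.

Lemma fillK v s u : 0 < v -> all (fun x => x < v) s -> collapse v (fill v s u) = u.
Proof.
move=> v0; elim: u s => [|[|x] u IHu] s //= sv; last by rewrite IHu // addnK.
by case: s sv => [|y s] /= => [_|/andP[yv sv]]; rewrite ?IHu //; congr (_ :: _); lia.
Qed.

Lemma collapseK v u : v \notin u -> fill v [seq x <- u | x < v] (collapse v u) = u.
Proof.
elim: u => //= x u IHu; rewrite inE negb_or => /andP[xv /IHu uE].
case: (ltngtP x v) xv => //= vx _.
  by rewrite (_ : x - v = 0) /= ?uE //; lia.
by case E : (x - v) => [|y]; [lia|rewrite /= uE -E subnK // ltnW].
Qed.

Lemma filter_fill v s u : all (fun x => x < v) s -> count_mem 0 u = size s ->
  [seq x <- fill v s u | x < v] = s.
Proof.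
elim: u s => [|[|x] u IHu] s /= sv.
- by case: s {sv}.
- case: s sv => //= y s /andP[yv sv] [us]; rewrite yv IHu //; lia.
- by move=> us; rewrite IHu // ifF //; lia.
Qed.

Lemma perm_fill v s u : count_mem 0 u = size s ->
  perm_eq (fill v s u) (s ++ [seq x + v | x <- pos u]).
Proof.
elim: u s => [|[|x] u IHu] s /=.
- by case: s.
- by case: s => //= y s [us]; rewrite perm_cons IHu //; lia.
- move=> us; rewrite perm_sym -cat1s perm_catCA /= perm_cons perm_sym IHu //.
Qed.

(** Truncated subtraction is monotone, so a pattern in the image comes from one in [u]. Conversely,
    a pattern [x], [y], [z] in [u] cannot have [y < v], as the letters below [v] increase; so [x]
    and [y] exceed [v], and the three images still decrease strictly. *)
Lemma av321_collapse v u : v \notin u -> sorted leq [seq x <- u | x < v] ->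
  av321 (collapse v u) = av321 u.
Proof.
move=> vu /sorted_leqP su; apply/idP/idP.
  move=> /av321P H; apply/av321P => x y z sub yx; rewrite leqNgt; apply/negP => zy.
  have sub2 : subseq [:: x; y] u by apply: subseq_trans sub; rewrite (prefix_subseq [:: x; y]).
  have sub2' : subseq [:: y; z] u by apply: subseq_trans sub; apply: (subseq_cons [:: y; z]).
  have ne t : t \in [:: x; y; z] -> t != v.
    by move=> ts; apply: contraNneq vu => <-; apply: (mem_subseq sub).
  have := ne x; have := ne y; have := ne z; rewrite !inE !eqxx !orbT => /(_ isT) zv /(_ isT) yv /(_ isT) xv.
  have := su x y; have := su y z; rewrite !subseq_filter /= sub2 sub2' !andbT => Hyz Hxy.
  have := H (x - v) (y - v) (z - v) (map_subseq (fun x => x - v) sub).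
  case: (ltnP y v) => yv'; case: (ltnP x v) => xv'; case: (ltnP z v) => zv'; rewrite ?yv' ?xv' ?zv' /= in Hyz Hxy *; lia.
elim: u {vu su} => //= x u IHu /andP[su /IHu ->]; rewrite andbT.
rewrite filter_map sorted_map.
have : sorted leq [seq y <- u | y - v < x - v].
  apply: (subseq_sorted leq_trans _ su); rewrite (eq_filter (a2 := predI (fun y => y - v < x - v) (fun y => y < x))).
    by rewrite filter_predI filter_subseq.
  by move=> y /=; lia.
by apply: sub_sorted => a b /=; lia.
Qed.

Lemma sorted_pos s : sorted leq s -> s = nseq (count_mem 0 s) 0 ++ pos s.
Proof.
elim: s => //= x s IHs xs; have ss := path_sorted xs.
case: x xs => [|x] xs; first by rewrite /= -IHs.
have all_s : all (fun y => 0 < y) s.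
  by apply: sub_all (order_path_min leq_trans xs) => y /=; lia.
have c0 : count_mem 0 s = 0 by apply/count_memPn/negP => /(allP all_s).
by rewrite /= c0 pos_all.
Qed.

Lemma filter_iota_lt k v : v <= k -> [seq x <- iota 1 k | x < v.+1] = iota 1 v.
Proof.
move=> vk; rewrite -{1}(subnKC vk) iotaD filter_cat [X in _ ++ X](_ : _ = [::]).
  by rewrite cats0 (all_filterP _) //; apply/allP => y; rewrite mem_iota; lia.
apply/eqP; rewrite -(negbK (_ == _)) -has_filter; apply/hasPn => y; rewrite mem_iota; lia.
Qed.

Lemma filter_iota_gt k v : v <= k ->
  [seq x <- iota 1 k | v < x] = [seq x + v | x <- iota 1 (k - v)].
Proof.
move=> vk; rewrite -{1}(subnKC vk) iotaD filter_cat [X in X ++ _](_ : _ = [::]).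
  rewrite (all_filterP _); last by apply/allP => y; rewrite mem_iota; lia.
  by rewrite addnC iotaDl; apply: eq_map => x; rewrite addnC.
apply/eqP; rewrite -(negbK (_ == _)) -has_filter; apply/hasPn => y; rewrite mem_iota; lia.
Qed.

(** The letters below [v.+1] that follow an initial [v.+1] in a 321-avoiding word with [m] blanks,
    in the only order they can have. *)
Definition small m v := nseq m 0 ++ iota 1 v.

Lemma small_lt m v : all (fun x => x < v.+1) (small m v).
Proof. by rewrite all_cat all_nseq orbT; apply/allP => x; rewrite mem_iota; lia. Qed.

Lemma small_sorted m v : sorted leq (small m v).
Proof.
elim: m => [|m IHm]; first exact: iota_sorted.
by rewrite /= path_sortedE ?IHm ?andbT; [apply/allP|apply: leq_trans].
Qed.

Lemma size_small m v : size (small m v) = m + v.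
Proof. by rewrite size_cat size_nseq size_iota. Qed.

Lemma cons_fillP (m v : nat) u : let u' := collapse v.+1 u in
  [&& reduced (v.+1 :: u), av321 (v.+1 :: u) & count_mem 0 u == m] ->
  [/\ reduced u', av321 u', count_mem 0 u' = m + v & u = fill v.+1 (small m v) u'].
Proof.
move=> u'; rewrite {}/u' => /and3P[ru] /=; set k := size (pos u) => /andP[su au] /eqP um.
have pu : perm_eq (v.+1 :: pos u) (iota 1 k.+1) by [].
have vu : v.+1 \notin u.
  by have := perm_uniq pu; rewrite iota_uniq /= mem_filter /= => /andP[].
have vk : v <= k by have := perm_mem pu v.+1; rewrite mem_head mem_iota; lia.
have sE : [seq x <- u | x < v.+1] = small m v.
  rewrite (sorted_pos su); congr (nseq _ _ ++ _).
    by rewrite -um count_filter; apply: eq_count => x /=; lia.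
  apply: (sorted_eq leq_trans anti_leq); last first.
  - have := perm_filter (fun x => x < v.+1) pu.
    by rewrite filter_iota_lt ?pos_filterC; [rewrite /= ltnn|lia].
  - exact: iota_sorted.
  - by apply: subseq_sorted su; [apply: leq_trans|apply: filter_subseq].
split.
- apply: (@perm_reduced _ (k - v)); apply: (perm_map_inj (@addIn v.+1)).
  rewrite /pos /collapse filter_map -map_comp [X in perm_eq X]map_id_in; last first.
    by move=> x; rewrite mem_filter /=; lia.
  rewrite (eq_filter (a2 := predI (fun x => v.+1 < x) (fun x => 0 < x))); last by move=> x /=; lia.
  rewrite filter_predI -/(pos u).
  have := perm_filter (fun x => v.+1 < x) pu.
  by rewrite filter_iota_gt /= ?ltnn // ltnS.
- by rewrite av321_collapse.
- rewrite -size_small -sE size_filter count_map; apply: eq_in_count => x xu /=.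
  by have : x != v.+1; [apply: contraNneq vu => <-|lia].
- by rewrite -sE collapseK.
Qed.

Lemma cons_fill (m v : nat) u : reduced u -> av321 u -> count_mem 0 u = m + v ->
  let w := fill v.+1 (small m v) u in
  [/\ reduced (v.+1 :: w), av321 (v.+1 :: w) & count_mem 0 w = m].
Proof.
move=> ru au um w; rewrite -(size_small m v) in um.
have pw := perm_fill v.+1 um.
have sw : [seq x <- w | x < v.+1] = small m v by rewrite filter_fill ?small_lt.
have vw : v.+1 \notin w.
  rewrite (perm_mem pw) mem_cat negb_or; apply/andP; split.
    by apply/negP => /(allP (small_lt m v)); rewrite ltnn.
  by apply/mapP => -[x]; rewrite mem_filter; lia.
have aw : av321 w.
  by rewrite -(av321_collapse vw) ?fillK ?sw ?small_sorted ?small_lt.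
split; last first.
- have -> : count_mem 0 w = count_mem 0 [seq x <- w | x < v.+1].
    by rewrite count_filter; apply: eq_count => x /=; lia.
  rewrite sw count_cat count_nseq mul1n (count_memPn _) ?addn0 //.
  by rewrite mem_iota; lia.
- by rewrite /= sw small_sorted.
apply: (@perm_reduced _ (v.+1 + size (pos u))).
rewrite [pos _]/=.
have -> : iota 1 (v.+1 + size (pos u)) =
    rcons (iota 1 v) v.+1 ++ [seq x + v.+1 | x <- iota 1 (size (pos u))].
  rewrite -cats1 -(iotaD 1 v 1) addn1 iotaD -addnC iotaDl; congr (_ ++ _).
  by apply: eq_map => x; rewrite addnC.
rewrite -cat1s perm_sym -cats1 -catA perm_catCA perm_cat2l perm_sym.
apply: (perm_trans (perm_filter _ pw)); rewrite filter_cat; apply: perm_cat.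
  rewrite filter_cat filter_nseq /= (all_filterP _) //.
  by apply/allP => x; rewrite mem_iota => /andP[].
rewrite (all_filterP _); first exact: perm_map.
by rewrite all_map; apply/allP => x _ /=; lia.
Qed.

Definition cons_pos (l : nat -> seq (seq nat)) n m :=
  [seq v.+1 :: fill v.+1 (small m v) u | v <- iota 0 n, u <- l (m + v)].

(** The number [m] of blanks is a parameter because removing a first letter [v.+1] creates [v] new
    blanks. *)
Fixpoint words321 n m : seq (seq nat) := match n with
  | 0 => if m is 0 then [:: [::]] else [::]
  | n'.+1 => (if m is m'.+1 then [seq 0 :: u | u <- words321 n' m'] else [::])
             ++ cons_pos (words321 n') n m
  end.

Lemma reduced0 u : reduced (0 :: u) = reduced u.
Proof. by []. Qed.

Lemma av321_0 u : av321 (0 :: u) = av321 u.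
Proof. by rewrite /= (eq_filter (a2 := pred0)) // filter_pred0. Qed.

Lemma mem_words321 n m w : (w \in words321 n m) =
  [&& size w == n, reduced w, av321 w & count_mem 0 w == m].
Proof.
elim: n m w => [|n IHn] m w.
  by case: w m => [|x w] [|m].
rewrite [words321 _ _]/= mem_cat; apply/orP/and4P.
  case=> [|/allpairsPdep[v [u [_ + ->]]]].
    case: m => // m /mapP[u]; rewrite IHn => /and4P[su ru au cu] ->.
    by rewrite reduced0 av321_0.
  rewrite IHn => /and4P[/eqP su ru au /eqP cu].
  have [-> -> cw] := cons_fill ru au cu; split => //; last by rewrite /= cw.
  rewrite /= eqSS -su -(size_map (subn^~ v.+1)) -/(collapse _ _) fillK ?small_lt //.
case: w => [|[|v] u] [] //= su ru au cu.
  left; case: m cu => // m cu; apply: map_f; rewrite IHn -eqSS su -reduced0 ru.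
  by rewrite -av321_0 /= au.
right; have h : [&& reduced (v.+1 :: u), av321 (v.+1 :: u) & count_mem 0 u == m].
  by rewrite ru /= au.
have [ru' au' cu' uE] := cons_fillP h.
apply/allpairsPdep; exists v, (collapse v.+1 u); split; last by rewrite -uE.
  rewrite mem_iota /=; have := perm_mem ru v.+1; rewrite mem_head mem_iota /=.
  by have := size_pos u; move: su; lia.
by rewrite IHn size_map -eqSS su ru' au' cu' eqxx.
Qed.

Lemma uniq_words321 n m : uniq (words321 n m).
Proof.
elim: n m => [|n IHn] m; first by case: m.
rewrite [words321 _ _]/= cat_uniq; apply/and3P; split.
- by case: m => // m; rewrite map_inj_uniq // => x y [].
- apply/hasPn => w /allpairsPdep[v [u [_ _ ->]]]; case: m => // m.
  by apply/mapP => -[].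
apply: allpairs_uniq_dep => //; first exact: iota_uniq.
move=> _ _ /allpairsPdep[v [u [_ _ ->]]] /allpairsPdep[v' [u' [_ _ ->]]] /= [<-].
by move=> /(congr1 (collapse v.+1)); rewrite !fillK ?small_lt // => ->.
Qed.

Lemma words321_big n m : n < m -> words321 n m = [::].
Proof.
move=> nm; case E : (words321 n m) => [//|w l].
have : w \in words321 n m by rewrite E mem_head.
rewrite mem_words321 => /and4P[/eqP sw _ _ /eqP cw].
by have := count_size (pred1 0) w; rewrite sw cw; lia.
Qed.

Lemma size_words321 n m : size (words321 n.+1 m) =
  (if m is m'.+1 then size (words321 n m') else 0) + \sum_(v < n.+1) size (words321 n (m + v)).
Proof.
rewrite [words321 _ _]/= size_cat; congr (_ + _); first by case: m => // m; rewrite size_map.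
by rewrite size_allpairs_dep -(sumn_map_iota (fun v => size (words321 n (m + v)))).
Qed.

Definition avoiders321 n := flatten [seq words321 n m | m <- iota 0 n.+1].

Lemma mem_avoiders321 n w : (w \in avoiders321 n) = [&& size w == n, reduced w & av321 w].
Proof.
apply/flattenP/and3P => [[l /mapP[m _ ->]]|[sw rw aw]].
  by rewrite mem_words321 => /and4P[-> -> ->].
exists (words321 n (count_mem 0 w)); last by rewrite mem_words321 sw rw aw eqxx.
by apply: map_f; rewrite mem_iota; have := count_size (pred1 0) w; move: sw; lia.
Qed.

Lemma uniq_avoiders321 n : uniq (avoiders321 n).
Proof.
rewrite /avoiders321; elim: (n.+1) => // k IHk.
rewrite -addn1 iotaD map_cat flatten_cat cat_uniq IHk /= cats0 uniq_words321 andbT.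
apply/hasPn => w; rewrite mem_words321 => /and4P[_ _ _ /eqP cw].
apply/negP => /flattenP[l /mapP[m + ->]]; rewrite mem_words321 mem_iota.
by move=> + /and4P[_ _ _ /eqP]; lia.
Qed.

Definition blankfree (w : seq nat) := 0 \notin w.

(** Removing the first letter of a blank-free word leaves a word with any number of blanks, and that
    number tells which letter was removed. *)
Lemma size_avoiders321 n : size (avoiders321 n) = size (words321 n.+1 0).
Proof.
rewrite size_words321 add0n /avoiders321 size_flatten /shape -map_comp.
by rewrite (sumn_map_iota (fun m => size (words321 n m))).
Qed.

Lemma count_blankfree_avoiders321 n : count blankfree (avoiders321 n) = size (words321 n 0).
Proof.
rewrite -size_filter; apply/perm_size/uniq_perm; rewrite ?uniq_words321 ?filter_uniq ?uniq_avoiders321 //.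
move=> w; rewrite mem_filter mem_avoiders321 mem_words321 andbC.
by rewrite /blankfree (sameP count_memPn eqP) -!andbA.
Qed.

(** The first-letter recursions for [m] and [m.+1] share all terms from [m.+1] blanks on. The
    remaining term of the sum for [m] equals the blank case for [m.+1], and the top term of the sum
    for [m.+1] is empty. *)
Lemma ballot n m : size (words321 n.+1 m) = size (words321 n.+1 m.+1) +
   if m is m'.+1 then size (words321 n m') else 0.
Proof.
rewrite !size_words321 addnC; congr (_ + _).
rewrite big_ord_recl addn0; congr (_ + _).
rewrite [RHS]big_ord_recr /= words321_big ?addn0; last lia.
by apply: eq_bigr => i _; rewrite addnS.
Qed.

Definition pred_term (g : nat -> nat) m := if m is m'.+1 then g m' else 0.

(* Both sides vanish for [n.+1 < m] and have the same differences in [m]. *)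
Lemma ballot_conv (g : nat -> nat -> nat) :
  g 0 0 = 1 -> (forall n m, n < m -> g n m = 0) ->
  (forall n m, g n.+1 m = g n.+1 m.+1 + pred_term (g n) m) ->
  forall n m, g n.+1 m = pred_term (g n) m + \sum_(i < n.+1) g i 0 * g (n - i) m.
Proof.
move=> g00 gbig gS; elim=> [|n IHn] m.
  rewrite big_ord1 subnn g00 mul1n; case: m => [|[|m]] /=.
  - by rewrite gS (gS 0 1) /= g00 !gbig.
  - by rewrite gS /= g00 !gbig.
  - by rewrite !gbig.
have [k] : exists k, n.+3 <= m + k by exists n.+3; lia.
elim: k m => [|k IHk] m mk.
  rewrite gbig ?big1; last by lia.
    by case: m mk => // m mk /=; rewrite gbig //; lia.
  by move=> i _; rewrite (gbig (n.+1 - i)) ?muln0 //; lia.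
have {}IHk := IHk m.+1 ltac:(lia).
rewrite gS IHk [in LHS]big_ord_recr [in RHS]big_ord_recr /= subnn (gbig 0 m.+1) // muln0 addn0.
have -> : \sum_(i < n.+1) g i 0 * g (n.+1 - i) m =
    \sum_(i < n.+1) g i 0 * g (n.+1 - i) m.+1 +
    pred_term (fun m' => \sum_(i < n.+1) g i 0 * g (n - i) m') m.
  have -> : pred_term (fun m' => \sum_(i < n.+1) g i 0 * g (n - i) m') m
    = \sum_(i < n.+1) g i 0 * pred_term (g (n - i)) m.
    by case: m {mk IHk} => //=; rewrite big1 // => i _; rewrite muln0.
  rewrite -big_split /=; apply: eq_bigr => i _; rewrite -mulnDr.
  have li : i <= n by rewrite -ltnS.
  by rewrite (subSn li) (gS (n - i) m).
case: m {mk IHk} => [|m] /=.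
  by rewrite g00 muln1 !addn0 add0n addnC.
rewrite (gbig 0 m.+1) // muln0 addn0.
have := IHn m; have := gS n m.
move: (\sum_(i < _) _) (\sum_(i < _) _) => X Y; lia.
Qed.

Lemma size_words321_conv n m : size (words321 n.+1 m) =
  pred_term (fun m => size (words321 n m)) m
   + \sum_(i < n.+1) size (words321 i 0) * size (words321 (n - i) m).
Proof.
apply: (ballot_conv (g := fun n m => size (words321 n m))) => //.
  by move=> k l kl; rewrite words321_big.
exact: ballot.
Qed.

(** * Direct sums: cutting a 321-avoiding word at its first fixed point *)

Definition shift v x := if x == 0 then 0 else x + v.
(* The direct sum [u + 1 + w]. *)
Definition osum (u w : seq nat) :=
  u ++ (size (pos u)).+1 :: [seq shift (size (pos u)).+1 x | x <- w].

Lemma ltn_shift v x y : (shift v x < shift v y) = (x < y).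
Proof. by rewrite /shift; case: eqP; case: eqP; lia. Qed.

Lemma shift_inj v : injective (shift v).
Proof. by move=> x y; rewrite /shift; case: eqP; case: eqP; lia. Qed.

Lemma pos_shift v w : pos (map (shift v) w) = [seq x + v | x <- pos w].
Proof. by elim: w => //= -[|x] w IHw //=; rewrite IHw. Qed.

Lemma av321_shift v w : av321 (map (shift v) w) = av321 w.
Proof.
elim: w => //= x u ->; rewrite filter_map sorted_map; congr (_ && _).
rewrite (eq_filter (a2 := fun y => y < x)); last by move=> y /=; rewrite ltn_shift.
by rewrite (eq_sorted (e' := leq)) // => y z /=; rewrite leqNgt ltn_shift -leqNgt.
Qed.

Lemma av321_cat_le u w : (forall x y, x \in u -> y \in w -> x <= y) ->
  av321 (u ++ w) = av321 u && av321 w.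
Proof.
elim: u => //= x u IHu H; rewrite IHu; last by move=> a b au; apply: H; rewrite inE au orbT.
rewrite -andbA filter_cat [X in _ ++ X](_ : _ = [::]) ?cats0 //.
apply/eqP; rewrite -(negbK (_ == _)) -has_filter; apply/hasPn => y yw.
by rewrite -leqNgt; apply: H; rewrite ?mem_head.
Qed.

Lemma iota_split k l : iota 1 (k.+1 + l) = iota 1 k ++ k.+1 :: [seq x + k.+1 | x <- iota 1 l].
Proof.
rewrite addSnnS iotaD add1n /=; congr (_ ++ _ :: _).
by rewrite -[k.+2]addn1 iotaDl; apply: eq_map => x; rewrite addnC.
Qed.

(** No letter of [u] exceeds [size (pos u)], so only blanks of [w] can lie below letters of [u];
    either [w] has none or [u] consists of blanks. After the middle letter, the smaller letters are
    all blanks and hence sorted. *)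
Lemma osum_avoiders321 u w : reduced u -> av321 u -> reduced w -> av321 w ->
  blankfree w || (pos u == [::]) ->
  [/\ reduced (osum u w), av321 (osum u w) & offset 0 (osum u w)].
Proof.
move=> ru au rw aw buw; set k := size (pos u).
have pE : pos (osum u w) = pos u ++ k.+1 :: [seq x + k.+1 | x <- pos w].
  by rewrite /osum pos_cat /= pos_shift.
split.
- apply: (@perm_reduced _ (k.+1 + size (pos w))); rewrite pE iota_split.
  by apply: perm_cat => //; rewrite perm_cons; apply: perm_map.
- rewrite av321_cat_le ?au /= ?av321_shift ?aw ?andbT.
    apply/sorted_leqP => y z /mem_subseq sub; suff -> : y = 0 by [].
    have := sub y (mem_head _ _); rewrite mem_filter => /andP[+ /mapP[t _ E]].
    by rewrite E /shift; case: eqP => //; lia.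
  move=> x y xu; have xk : x <= k.
    case: (posnP x) => [->//|x0].
    by have /reducedP[_ /(_ x)] := ru; rewrite xu x0 /= => /esym.
  rewrite inE => /orP[/eqP->|/mapP[t tw ->]]; first by rewrite ltnW.
  case/orP: buw => [bw|/eqP p0]; last by move: xk; rewrite /k p0 leqn0 => /eqP->.
  rewrite /shift; case: eqP => [t0|_]; last by lia.
  by move: bw; rewrite /blankfree -t0 tw.
- by rewrite offset_cat /= orbC; apply/orP; left; apply/orP; left; apply/eqP; lia.
Qed.

Lemma osum_decomp z : reduced z -> av321 z -> offset 0 z ->
  exists u w, [/\ z = osum u w, [/\ reduced u, av321 u & ~~ offset 0 u],
    reduced w, av321 w & blankfree w || (pos u == [::])].
Proof.
move=> rz az /offset_first[u [x [v [zE x0 xE nu]]]].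
set k := size (pos u) in xE; have {x0}xE : x = k.+1 by lia.
subst x; have pE : pos z = pos u ++ k.+1 :: pos v by rewrite zE pos_cat.
set K := size (pos z) in rz *; have KE : K = k + (size (pos v)).+1 by rewrite /K pE size_cat.
have [uz mz] := reducedP _ rz.
have uk y : y \in pos u -> y <= k.
  rewrite mem_filter => /andP[y0 yu]; rewrite leqNgt; apply/negP => ky.
  have yk : y != k.+1.
    apply/eqP => yk; move: uz; rewrite pE cat_uniq => /and3P[_ /hasPn/(_ y) + _].
    by rewrite -yk mem_head mem_filter y0 yu => /(_ isT).
  (* Pigeonhole: [pos u] has [k] letters, among them [y > k.+1], so some positive [t <= k] is
     missing and comes after the fixed point. Then [y], [k.+1], [t] is a 321. *)
  have [/allP sub|] := boolP (all (mem (pos u)) (iota 1 k)).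
    have : size (y :: iota 1 k) <= size (pos u).
      apply: uniq_leq_size; first by rewrite /= iota_uniq andbT mem_iota; lia.
      by move=> t; rewrite inE => /orP[/eqP->|/sub//]; rewrite mem_filter y0.
    by rewrite /= size_iota ltnn.
  case/allPn => t tk tu; rewrite mem_iota in tk.
  have tz : (t \in z) && (0 < t) by rewrite mz -/K; lia.
  have tv : t \in v.
    move: tz; rewrite zE mem_cat inE => /andP[/or3P[tu'|/eqP|//] t0]; last by lia.
    by move: tu; rewrite /= mem_filter t0 tu'.
  have /av321P/(_ y k.+1 t) := az; rewrite zE -[[:: y; _; _]]cat1s.
  by rewrite cat_subseq ?sub1seq //= ?eqxx ?sub1seq //; lia.
have uu : uniq (pos u) by move: uz; rewrite pE cat_uniq => /andP[].
have pu : perm_eq (pos u) (iota 1 k).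
  apply: uniq_perm; rewrite ?iota_uniq //.
  have sub : {subset pos u <= iota 1 k}.
    by move=> y yu; rewrite mem_iota; move: (uk y yu); move: yu; rewrite mem_filter; lia.
  by have [] := uniq_min_size uu sub; rewrite ?size_iota.
have pv : perm_eq (pos v) [seq t + k.+1 | t <- iota 1 (size (pos v))].
  have : perm_eq (pos z) (iota 1 (k.+1 + size (pos v))).
    by rewrite addSnnS -KE.
  rewrite pE iota_split => E.
  rewrite -(perm_cons k.+1) -(perm_cat2l (iota 1 k)); apply: perm_trans E.
  by rewrite perm_cat2r perm_sym.
pose w := [seq t - k.+1 | t <- v].
have vE : v = map (shift k.+1) w.
  rewrite -map_comp map_id_in // => t tv /=; rewrite /shift.
  case: (posnP t) => [->|t0]; first by rewrite sub0n.
  have : t \in pos v by rewrite mem_filter t0.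
  rewrite (perm_mem pv) => /mapP[s]; rewrite mem_iota => s0 ->.
  by rewrite addnK; case: eqP; lia.
exists u, w; split.
- by rewrite zE /osum -/k -vE.
- split => //.
  by move: az; rewrite zE => /av321P H; apply/av321P => a b c sub; apply: H;
     apply: (subseq_trans sub); apply: prefix_subseq.
- apply: (@perm_reduced _ (size (pos v))).
  by apply: (perm_map_inj (@addIn k.+1)); rewrite -pos_shift -vE.
- rewrite -(av321_shift k.+1) -vE.
  move: az; rewrite zE => /av321P H; apply/av321P => a b c sub; apply: H.
  by apply: (subseq_trans sub); rewrite -cat_rcons; apply: suffix_subseq.
(* A descent in [pos u] followed by a blank of [v] would be a 321. So [pos u] is increasing, hence
   [iota 1 k], and unless it is empty its first letter is an earlier fixed point. *)
have [//|/negbNE bw] := boolP (blankfree w); apply/negbNE/negP => pu0.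
have v0 : 0 \in v by rewrite vE; apply/mapP; exists 0.
have su : sorted leq (pos u).
  apply/sorted_leqP => a b sub; rewrite leqNgt; apply/negP => ba.
  have /av321P/(_ a b 0) := az; rewrite zE -[[:: a; b; 0]]/([:: a; b] ++ [:: 0]).
  rewrite cat_subseq ?sub1seq ?inE ?v0 ?orbT //; last by apply: subseq_trans sub (filter_subseq _ _).
  have : b \in pos u by apply: (mem_subseq sub); rewrite !inE eqxx orbT.
  by rewrite mem_filter; lia.
have puE : pos u = iota 1 k.
  by apply: (sorted_eq leq_trans anti_leq) => //; apply: iota_sorted.
move: nu; rewrite -offset_pos puE; case: (k) puE => [|k'] puE; first by rewrite puE in pu0.
by [].
Qed.

Lemma avoiders321_renewal n :
  size (avoiders321 n) + \sum_(i < n) count blankfree (avoiders321 (n.-1 - i)) =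
  count (predC (offset 0)) (avoiders321 n)
   + \sum_(i < n) count (predC (offset 0)) (avoiders321 i) * count blankfree (avoiders321 (n.-1 - i))
   + \sum_(i < n) size (avoiders321 (n.-1 - i)).
Proof.
apply: (@renewal _ avoiders321 size _ blankfree (fun u => pos u == [::]) osum).
- exact: uniq_avoiders321.
- by move=> k w; rewrite mem_avoiders321 => /andP[/eqP].
- move=> k; rewrite (@eq_in_count _ _ (pred1 (nseq k 0))).
    rewrite count_uniq_mem ?uniq_avoiders321 // mem_avoiders321 size_nseq eqxx.
    by rewrite (_ : reduced _ && _) //; elim: k => // k /andP[rk ak]; rewrite reduced0 av321_0 rk ak.
  move=> w; rewrite mem_avoiders321 => /andP[/eqP<- _] /=; apply/andP/eqP => [[_ /eqP]|->].
    by elim: w => //= -[|x] w //= IHw /IHw {1}->.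
  by rewrite -offset_pos /pos filter_nseq.
- move=> x y x' y' _ _ _ _ dx _ dx' _ e.
  have [||-> _] := @offset_first_inj 0%R x (size (pos x)).+1 _ x' (size (pos x')).+1 _ isT _ dx isT _ dx' e; [lia|lia|].
  by move=> /(inj_map (@shift_inj _)).
- move=> k x y; rewrite !mem_avoiders321 => /and3P[_ rx ax] /and3P[_ ry ay] sk dx nxy.
  have [-> -> /= ->] := osum_avoiders321 rx ax ry ay nxy.
  by rewrite size_cat /= size_map addnS sk eqxx.
move=> k z; rewrite mem_avoiders321 => /and3P[/eqP sz rz az] /negbNE oz.
have [x [y [zE [rx ax ox] ry ay nxy]]] := osum_decomp rz az oz.
exists x, y; rewrite !mem_avoiders321 !eqxx rx ax ry ay; split => //.
by rewrite -sz zE size_cat /= size_map; lia.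
Qed.

(** * Catalan numbers *)

Definition catalan n := size (words321 n 0).

(** The case [m = 0] of the convolution, in which the predecessor term vanishes, is Segner's
    recurrence. *)
Lemma catalanS n : catalan n.+1 = \sum_(i < n.+1) catalan i * catalan (n - i).
Proof. by rewrite /catalan size_words321_conv. Qed.

Lemma count_nob_cat n : count nob (trees n) = catalan n.
Proof.
have [m] := ubnP n; elim: m n => // m IHm [//|n] nm.
rewrite count_nob_trees catalanS; apply: eq_bigr => i _.
by rewrite !IHm //; have := ltn_ord i; lia.
Qed.

Lemma size_trees_cat n : size (trees n) = catalan n.+1.
Proof.
have [m] := ubnP n; elim: m n => // m IHm [|n] nm.
  by rewrite catalanS big_ord1.
rewrite size_trees IHm; last by lia.
rewrite [in RHS]catalanS [in RHS]big_ord_recr /= subnn [RHS]addnC muln1; congr (_ + _); apply: eq_bigr => i _.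
rewrite count_nob_cat IHm; last by have := ltn_ord i; lia.
by have li : i <= n by [rewrite -ltnS]; rewrite (subSn li).
Qed.

Definition der_num n := count (predC (offset 0)) (avoiders321 n).

Lemma der_num_rec n : der_num n + \sum_(i < n) der_num i * catalan (n.-1 - i) + catalan n
  = (catalan n.+1).+1.
Proof.
have := avoiders321_renewal n; rewrite size_avoiders321 -/(catalan _).
under eq_bigr do rewrite count_blankfree_avoiders321 -/(catalan _).
under [X in _ + X + _]eq_bigr do rewrite count_blankfree_avoiders321 -/(catalan _).
under [X in _ + _ + X]eq_bigr do rewrite size_avoiders321 -/(catalan _).
rewrite -/(der_num n) => E.
(* Both sides are the sum of [catalan 0] to [catalan n], with [catalan 0 = 1] split off on the left
   and the last term on the right. *)
have T : \sum_(i < n) catalan (n.-1 - i).+1 + 1 = \sum_(i < n) catalan (n.-1 - i) + catalan n.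
  case: n {E} => [|n]; first by rewrite !big_ord0.
  rewrite big_ord_recl [in RHS]big_ord_recr /= subnn subn0.
  rewrite (eq_bigr (fun i : 'I_n => catalan (n - i))); last first.
    by move=> i _; congr catalan; rewrite /bump /=; have := ltn_ord i; lia.
  by rewrite (_ : catalan 0 = 1) //; move: (\sum_(i < n) _) (catalan n.+1) => X Y; lia.
move: E T; move: (\sum_(i < n) catalan _) (\sum_(i < n) catalan _) => X Y.
by move: (\sum_(i < n) _) => Z; lia.
Qed.

Lemma count_der_trees n : count (predC (has_at 0)) (trees n) = der_num n.
Proof.
have [m] := ubnP n; elim: m n => // m IHm n nm.
have := trees_renewal n; have := avoiders321_renewal n.
rewrite size_avoiders321 size_trees_cat -/(catalan _).
have -> : \sum_(i < n) count blankfree (avoiders321 (n.-1 - i)) = \sum_(i < n) count nob (trees (n.-1 - i)).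
  by apply: eq_bigr => i _; rewrite count_nob_cat count_blankfree_avoiders321.
have -> : \sum_(i < n) size (avoiders321 (n.-1 - i)) = \sum_(i < n) size (trees (n.-1 - i)).
  by apply: eq_bigr => i _; rewrite size_trees_cat size_avoiders321.
have -> : \sum_(i < n) count (predC (offset 0)) (avoiders321 i) * count blankfree (avoiders321 (n.-1 - i)) =
   \sum_(i < n) count (predC (has_at 0)) (trees i) * count nob (trees (n.-1 - i)).
  apply: eq_bigr => i _; rewrite count_nob_cat count_blankfree_avoiders321 IHm //.
  by apply: leq_trans (ltn_ord i) _.
by move=> -> /addIn/addIn.
Qed.

(** * Patterns in words with letter -1 and in words with blanks *)

Definition blank_int (x : nat) : int := if x == 0 then (-1)%R else x%:Z%R.

Lemma ltr_blank_int x y : (blank_int x < blank_int y)%R = (x < y).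
Proof. by rewrite /blank_int; case: eqP; case: eqP; lia. Qed.

Lemma blank_int_inj : injective blank_int.
Proof. by move=> x y; rewrite /blank_int; case: eqP; case: eqP; lia. Qed.

Lemma avoidsP w sigma :
  reflect (forall t, subseq t w -> red t <> sigma) (avoids w sigma).
Proof.
apply: (iffP forallP) => H.
  move=> t /subseqP[m sm ->]; apply/eqP.
  by have := H (Tuple (introT eqP sm)).
by move=> m; apply/eqP/H/subseqP; exists m; rewrite ?size_tuple.
Qed.

Lemma subseq_map_inv (f : nat -> int) t w : subseq t (map f w) ->
  exists2 t', subseq t' w & t = map f t'.
Proof.
case/subseqP => m sm ->; exists (mask m w); first exact: mask_subseq.
by rewrite map_mask.
Qed.

Lemma red3 (a b c : int) :
  ((red [:: a; b; c] == p321) = ((c < b) && (b < a))%R) *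
  ((red [:: a; b; c] == p132) = ((a < c) && (c < b))%R).
Proof.
rewrite /red /= !Order.POrderTheory.ltxx.
split; case: (Order.TotalTheory.ltgtP a b) => ab; case: (Order.TotalTheory.ltgtP b c) => bc;
  case: (Order.TotalTheory.ltgtP a c) => ac; rewrite /= ?inE ?ab ?bc ?ac ?eqxx //=; try lia.
all: try (have -> : (b == c) = false by lia); try (have -> : (a == c) = false by lia); by [].
Qed.

Lemma size_red t : size (red t) = size t.
Proof. exact: size_map. Qed.

Lemma avoids_321 w : avoids (map blank_int w) p321 = av321 w.
Proof.
apply/avoidsP/av321P => H.
  move=> x y z sub yx; rewrite leqNgt; apply/negP => zy.
  apply: (H _ (map_subseq blank_int sub)); apply/eqP.
  by rewrite red3 !ltr_blank_int zy.
move=> t /subseq_map_inv[t' sub ->] E; have := congr1 size E; rewrite size_red size_map.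
case: t' sub E => [|x [|y [|z [|]]]] //= sub /eqP; rewrite red3 !ltr_blank_int => /andP[zy yx] _.
by have := H _ _ _ sub yx; lia.
Qed.

Lemma avoids_132 w : avoids (map blank_int w) p132 = av132 w.
Proof.
apply/avoidsP/av132P => H.
  move=> x y z sub xz; rewrite leqNgt; apply/negP => zy.
  apply: (H _ (map_subseq blank_int sub)); apply/eqP.
  by rewrite red3 !ltr_blank_int xz.
move=> t /subseq_map_inv[t' sub ->] E; have := congr1 size E; rewrite size_red size_map.
case: t' sub E => [|x [|y [|z [|]]]] //= sub /eqP; rewrite red3 !ltr_blank_int => /andP[xz zy] _.
by have := H _ _ _ sub xz; lia.
Qed.

(** * The words of the permutations *)

Lemma index_sorted_ltn (s : seq nat) x : sorted ltn s -> x \in s ->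
  index x s = count (fun y => y < x) s.
Proof.
elim: s => //= y s IHs ys; rewrite inE.
have all_s := order_path_min ltn_trans ys.
case: eqVneq => [->|ne] /=.
  rewrite ltnn (eq_in_count (a2 := pred0)) ?count_pred0 // => z /(allP all_s) /=; lia.
move=> xs; have := allP all_s _ xs => /= yx.
by rewrite yx IHs // (path_sorted ys).
Qed.

Section Arrangement.
Variables (n : nat) (pi : 'S_n).

(* [index i moved] is the rank of [i] among the points moved by [pi]. *)
Definition moved := [seq i <- enum 'I_n | pi i != i].

Lemma mem_moved i : (i \in moved) = (pi i != i).
Proof. by rewrite mem_filter mem_enum andbT. Qed.

Lemma moved_pi i : (pi i \in moved) = (i \in moved).
Proof. by rewrite !mem_moved (inj_eq perm_inj). Qed.

Lemma uniq_moved : uniq moved.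
Proof. by rewrite filter_uniq ?enum_uniq. Qed.

Lemma sorted_moved : sorted ltn (map val moved).
Proof.
rewrite sorted_map /moved; apply: sorted_filter; first by move=> ? ? ?; apply: ltn_trans.
by rewrite -sorted_map val_enum_ord iota_ltn_sorted.
Qed.

(** Since [pi] permutes its moved points, the values that survive are again the moved points, and
    reducing a value means taking its rank among them. *)
Lemma dwordE : dword pi =
  [seq if pi i == i then (-1)%R else ((index (pi i) moved).+1)%:Z%R | i <- enum 'I_n].
Proof.
rewrite /dword /posred; set l := map _ (enum _).
rewrite /l -map_comp -/l; apply/eq_in_map => i _ /=.
case: eqP => //= /eqP pii.
congr (_.+1)%:Z%R.
have im : pi i \in moved by rewrite moved_pi mem_moved.
rewrite -(index_map val_inj) (index_sorted_ltn sorted_moved) ?map_f // count_map -size_filter.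
rewrite -(size_map (fun j : 'I_n => (j : nat).+1%:Z%R)).
apply/perm_size/uniq_perm; first exact: undup_uniq.
  rewrite map_inj_uniq; first by apply: filter_uniq; apply: uniq_moved.
  by move=> j k [] /val_inj.
move=> b; rewrite mem_undup mem_filter; apply/andP/mapP.
  case=> /andP[b0 bi] /mapP[j _ bE]; move: b0 bi; rewrite {}bE; case: eqP => // /eqP pj _ lt.
  by exists (pi j) => //; rewrite mem_filter moved_pi mem_moved pj andbT /=; lia.
case=> j; rewrite mem_filter => /andP[/= ji jm] ->.
split; first by lia.
apply/mapP; exists ((pi^-1)%g j); first by rewrite mem_enum.
rewrite permKV; have : (pi^-1)%g j \in moved by rewrite -moved_pi permKV.
by rewrite mem_moved permKV => /negbTE ->.
Qed.

(** Values and positions are both ranked along [moved], so a positive letter equal to its position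
    would come from a moved point with [pi i = i]. *)
Lemma dword_word : exists2 w, [&& size w == n, reduced w & ~~ offset 0 w] &
  dword pi = map blank_int w.
Proof.
pose f i := (index (pi i) moved).+1.
exists [seq if pi i == i then 0 else f i | i <- enum 'I_n]; last first.
  by rewrite dwordE -map_comp; apply: eq_map => i /=; case: eqP.
set w := map _ _.
have pw : pos w = map f moved.
  rewrite /pos /w filter_map (eq_filter (a2 := fun i => pi i != i)).
    by apply/eq_in_map => i; rewrite mem_filter => /andP[/negbTE ->].
  by move=> i /=; case: eqP.
have sp : perm_eq (map pi moved) moved.
  apply: uniq_perm; rewrite ?map_inj_uniq ?uniq_moved //; first exact: perm_inj.
  by move=> i; rewrite -[i](permKV pi) (mem_map perm_inj) moved_pi.
apply/and3P; split; first by rewrite size_map size_enum_ord.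
  apply: (@perm_reduced _ (size moved)); rewrite pw.
  have -> : map f moved = map (fun i => (index i moved).+1) (map pi moved) by rewrite -map_comp.
  apply: (perm_trans (perm_map _ sp)).
  have -> : [seq (index i moved).+1 | i <- moved] = map succn [seq index i moved | i <- moved].
    by rewrite -map_comp.
  have -> : [seq index i moved | i <- moved] = iota 0 (size moved).
    apply: (eq_from_nth (x0 := 0)); rewrite ?size_map ?size_iota // => p pm.
    case E : moved pm => [//|i0 r] pm; rewrite -E in pm *.
    by rewrite (nth_map i0) // nth_iota // index_uniq // uniq_moved.
  by rewrite (iotaDl 1 0).
rewrite -offset_pos pw; apply/negP => /offset_first[u [x [v [E x0 xE _]]]].
have pu : pos u = u.
  apply: pos_all; apply/allP => y yu.
  have : y \in map f moved by rewrite E mem_cat yu.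
  by case/mapP => j _ ->.
rewrite pu in xE.
have su : size u < size moved by rewrite -(size_map f) E size_cat /=; lia.
case Em : moved su => [//|i0 r]; rewrite -Em => su.
have := congr1 (fun s => nth 0 s (size u)) E.
rewrite nth_cat ltnn subnn /= (nth_map i0) // => fE.
set i := nth i0 moved (size u) in fE.
have im : i \in moved by apply: mem_nth.
have : index (pi i) moved = index i moved.
  by rewrite [RHS]index_uniq ?uniq_moved //; move: fE; rewrite /f; lia.
move/(congr1 (nth i0 moved)); rewrite !nth_index ?moved_pi // => pii.
by move: im; rewrite mem_moved pii eqxx.
Qed.

End Arrangement.

(** The permutation fixes the positions of blanks, and a letter [p.+1] becomes the [p]-th nonblank
    position, counted from 0. A nonblank position that it fixed would give a fixed point of [w]. *)
Lemma word_dword n w : size w = n -> reduced w -> ~~ offset 0 w ->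
  exists pi : 'S_n, dword pi = map blank_int w.
Proof.
move=> sw rw ow.
have wE : [seq nth 0 w (i : 'I_n) | i <- enum 'I_n] = w.
  by rewrite (map_comp (nth 0 w) val) val_enum_ord -sw map_nth_iota0 // take_size.
pose s := [seq i <- enum 'I_n | nth 0 w (i : 'I_n) != 0].
have us : uniq s by rewrite filter_uniq ?enum_uniq.
have ms (i : 'I_n) : (i \in s) = (nth 0 w i != 0) by rewrite mem_filter mem_enum andbT.
have ps : pos w = [seq nth 0 w (i : 'I_n) | i <- s].
  rewrite -{1}wE /pos filter_map; congr map; apply: eq_filter => i /=; lia.
have [upw mw] := reducedP _ rw.
have szs : size s = size (pos w) by rewrite ps size_map.
have lts (i : 'I_n) : i \in s -> (nth 0 w i).-1 < size s.
  rewrite ms szs => wi; have := mw (nth 0 w i); rewrite mem_nth ?sw //=; lia.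
pose f (i : 'I_n) : 'I_n := if nth 0 w i == 0 then i else nth i s (nth 0 w i).-1.
have fs (i : 'I_n) : (f i \in s) = (i \in s).
  rewrite /f; case: eqP => // /eqP wi; rewrite [RHS]ms wi mem_nth //.
  by apply: lts; rewrite ms.
have f_inj : injective f.
  move=> i j E; have := fs i; rewrite E fs => sij.
  move: E; rewrite /f; case: eqP => [wi|/eqP wi]; case: eqP => [wj|/eqP wj] //.
  - by move: sij; rewrite !ms wi wj.
  - by move: sij; rewrite !ms wi wj.
  have is_ : i \in s by rewrite ms. 
  have js : j \in s by rewrite ms.
  rewrite (set_nth_default j) ?lts // => /eqP; rewrite nth_uniq ?lts // => /eqP e.
  have ew : nth 0 w i = nth 0 w j by lia.
  have := nth_uniq 0 (i := index i s) (j := index j s) _ _ upw.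
  rewrite ps !(nth_map i) ?size_map ?index_mem // !nth_index // ew eqxx.
  move=> /(_ is_ js)/esym/eqP/(congr1 (nth i s)).
  by rewrite !nth_index.
pose pi := perm f_inj.
have piE (i : 'I_n) : (pi i == i) = (nth 0 w i == 0).
  rewrite permE /f; case: (nth 0 w i =P 0) => [_|/eqP wi]; first by rewrite eqxx.
  have is_ : i \in s by rewrite ms.
  apply/negP => /eqP e; move/negP: ow; apply; rewrite -offset_pos.
  have ie : index i s = (nth 0 w i).-1 by rewrite -{1}e index_uniq // lts.
  set p := index i s in ie; have lp : p < size (pos w) by rewrite -szs /p index_mem.
  rewrite -(cat_take_drop p (pos w)) (drop_nth 0) // offset_cat.
  have -> : nth 0 (pos w) p = p.+1.
    by rewrite ps (nth_map i) ?szs // nth_index // ie; lia.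
  rewrite [pos (take _ _)]pos_all; last by apply/allP => y /mem_take; rewrite mem_filter => /andP[].
  rewrite size_take lp /=; apply/orP; right; apply/orP; left; apply/eqP; lia.
exists pi; rewrite dwordE -[in RHS]wE -map_comp; apply: eq_map => i /=.
have -> : moved pi = s by apply: eq_filter => j; rewrite piE.
rewrite piE /blank_int; case: eqP => // /eqP wi.
have is_ : i \in s by rewrite ms.
by rewrite permE /f (negbTE wi) index_uniq ?lts // prednK // lt0n.
Qed.

Lemma Dn1P n W : reflect
  (exists2 w, [&& size w == n, reduced w & ~~ offset 0 w] & W = map blank_int w) (W \in Dn1 n).
Proof.
rewrite mem_undup; apply: (iffP mapP) => [[pi _ ->]|[w /and3P[/eqP sw rw ow] ->]].
  exact: dword_word.
by have [pi <-] := word_dword sw rw ow; exists pi; rewrite // mem_enum inE.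
Qed.

Lemma Dcount_enum n sigma (X : eqType) (l : seq X) (f : X -> seq nat) :
  uniq l -> {in l &, injective f} ->
  (forall w, reflect (exists2 x, x \in l & w = f x)
     [&& size w == n, reduced w, ~~ offset 0 w & avoids (map blank_int w) sigma]) ->
  Dcount n sigma = size l.
Proof.
move=> ul fi H; rewrite /Dcount -size_filter -(size_map (map blank_int \o f)).
apply/perm_size/uniq_perm; first by rewrite filter_uniq ?undup_uniq.
  rewrite map_inj_in_uniq // => x y xl yl /= /(inj_map blank_int_inj) e; exact: fi.
move=> W; rewrite mem_filter; apply/andP/mapP.
  case=> aW /Dn1P[w /and3P[sw rw ow] WE].
  have /H[x xl wE] : [&& size w == n, reduced w, ~~ offset 0 w & avoids (map blank_int w) sigma].
    by rewrite sw rw ow -WE.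
  by exists x => //; rewrite WE wE.
case=> x xl WE; have /and4P[sw rw ow aw] : [&& size (f x) == n, reduced (f x),
   ~~ offset 0 (f x) & avoids (map blank_int (f x)) sigma] by apply/H; exists x.
split; first by rewrite WE.
by apply/Dn1P; exists (f x) => //; rewrite sw rw.
Qed.

Lemma Dcount_321 n : Dcount n p321 = der_num n.
Proof.
rewrite /der_num -size_filter; apply: (Dcount_enum (f := id)).
- by rewrite filter_uniq ?uniq_avoiders321.
- by move=> x y.
move=> w; rewrite avoids_321; apply: (iffP and4P) => [[sw rw ow aw]|[x + ->]].
  by exists w => //; rewrite mem_filter mem_avoiders321 /= ow sw rw.
by rewrite mem_filter mem_avoiders321 => /and4P[].
Qed.

Lemma Dcount_132 n : Dcount n p132 = der_num n.
Proof.
rewrite -count_der_trees -size_filter; apply: (Dcount_enum (f := word)).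
- by rewrite filter_uniq ?uniq_trees_upto.
- move=> x y; rewrite !mem_filter !mem_trees => /and3P[_ okx _] /and3P[_ oky _].
  exact: word_inj.
move=> w; rewrite avoids_132; apply: (iffP and4P) => [[/eqP sw rw ow aw]|[t + ->]].
  have [t okt wE] := word_surj rw aw; exists t => //.
  by rewrite mem_filter mem_trees /= -offset_word // wE ow okt -size_word wE sw eqxx.
rewrite mem_filter mem_trees /= => /and3P[ht okt lt].
by rewrite size_word reduced_word // offset_word // av132_word.
Qed.

End Combinatorics.

From Stdlib Require Import Reals Lra Lia.
From Coquelicot Require Import Coquelicot.
Open Scope R_scope.

(** * Generating functions *)

Section GeneratingFunction.
Variables c a : nat -> R.
Hypothesis c0 : c 0%nat = 1.
Hypothesis c_ge0 : forall n, 0 <= c n.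
Hypothesis cS : forall n, c (S n) = sum_f_R0 (fun i => c i * c (n - i)%nat) n.
Hypothesis a0 : a 0%nat = 1.
Hypothesis a_ge0 : forall n, 0 <= a n.
Hypothesis aS : forall n,
  a (S n) + sum_f_R0 (fun i => a i * c (n - i)%nat) n + c (S n) = c (S (S n)) + 1.

Lemma sum_conv_pow (u v : nat -> R) x n :
  sum_f_R0 (fun i => (u i * x ^ i) * (v (n - i)%nat * x ^ (n - i))) n =
  sum_f_R0 (fun i => u i * v (n - i)%nat) n * x ^ n.
Proof.
rewrite Rmult_comm, scal_sum; apply sum_eq; intros i li.
replace (x ^ n) with (x ^ i * x ^ (n - i)) by (rewrite <- pow_add; f_equal; lia).
ring.
Qed.

(** The antidiagonals up to [N] are part of the square of products [u i * u j], and the rest of the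
    square is nonnegative. *)
Lemma sum_conv_le_sqr (u : nat -> R) N : (forall n, 0 <= u n) ->
  sum_f_R0 (fun n => sum_f_R0 (fun i => u i * u (n - i)%nat) n) N
  <= sum_f_R0 u N * sum_f_R0 u N.
Proof.
intros u0; destruct N as [|N]; [simpl; lra|].
rewrite cauchy_finite by lia.
rewrite <- (Rplus_0_r (sum_f_R0 _ (S N))) at 1.
apply Rplus_le_compat_l, cond_pos_sum; intros k.
apply cond_pos_sum; intros l; now apply Rmult_le_pos.
Qed.

(** By the recurrence, each partial sum is at most [1 + s^2/4], where [s] is the preceding one; 2 is
    the fixed point of this map. *)
Lemma partial_sum_le2 N : sum_f_R0 (fun n => c n * (/ 4) ^ n) N <= 2.
Proof.
assert (pos : forall n, 0 <= c n * (/ 4) ^ n).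
  intros n; apply Rmult_le_pos; [apply c_ge0|apply pow_le; lra].
induction N as [|N IH]; [simpl; lra|].
rewrite decomp_sum by lia; simpl pred.
replace (sum_f_R0 _ N) with (/ 4 * sum_f_R0 (fun n => sum_f_R0 (fun i =>
    (c i * (/ 4) ^ i) * (c (n - i)%nat * (/ 4) ^ (n - i))) n) N).
  pose proof (sum_conv_le_sqr _ N pos) as H.
  pose proof (cond_pos_sum _ N pos) as H0.
  simpl (c 0%nat * _); rewrite c0; nra.
rewrite scal_sum; apply sum_eq; intros i _.
rewrite sum_conv_pow, cS; simpl; ring.
Qed.

Lemma ex_series_c4 : ex_series (fun n => c n * (/ 4) ^ n).
Proof.
destruct (ex_finite_lim_seq_incr (sum_n (fun n => c n * (/ 4) ^ n)) 2) as [l Hl].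
- intros n; rewrite sum_Sn; unfold plus; simpl.
  assert (0 <= c (S n) * (/ 4 * (/ 4) ^ n)); [|lra].
  apply Rmult_le_pos; [apply c_ge0|]; apply (pow_le (/ 4) (S n)); lra.
- intros n; rewrite sum_n_Reals; apply partial_sum_le2.
- exists l; exact Hl.
Qed.

Lemma Series_c4_le2 : Series (fun n => c n * (/ 4) ^ n) <= 2.
Proof.
assert (H := Series_correct _ ex_series_c4).
apply (is_lim_seq_le (sum_n (fun n => c n * (/ 4) ^ n)) (fun _ => 2)
  (Series (fun n => c n * (/ 4) ^ n)) 2); [|exact H|apply is_lim_seq_const].
intros n; rewrite sum_n_Reals; apply partial_sum_le2.
Qed.

Variable x : R.
Hypothesis x0 : x <> 0.
Hypothesis x4 : Rabs x < / 4.

Let C := Series (fun n => c n * x ^ n).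

Lemma abs_c_le n : 0 <= Rabs (c n * x ^ n) <= c n * (/ 4) ^ n.
Proof.
split; [apply Rabs_pos|].
rewrite Rabs_mult, (Rabs_pos_eq _ (c_ge0 n)), <- RPow_abs.
apply Rmult_le_compat_l; [apply c_ge0|].
apply pow_incr; split; [apply Rabs_pos|lra].
Qed.

Lemma ex_series_abs_c : ex_series (fun n => Rabs (c n * x ^ n)).
Proof.
apply (ex_series_le (K := R_AbsRing) (V := R_CompleteNormedModule) _ (fun n => c n * (/ 4) ^ n)); [|exact ex_series_c4].
intros n; unfold norm; simpl; unfold abs; simpl.
rewrite Rabs_Rabsolu; apply abs_c_le.
Qed.

Lemma is_series_c : is_series (fun n => c n * x ^ n) C.
Proof. apply Series_correct, ex_series_Rabs, ex_series_abs_c. Qed.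

Lemma abs_C_le2 : Rabs C <= 2.
Proof.
apply Rle_trans with (2 := Series_c4_le2).
apply Rle_trans with (1 := Series_Rabs _ ex_series_abs_c).
apply Series_le; [exact abs_c_le|exact ex_series_c4].
Qed.

Lemma is_series_c_shift : is_series (fun n => c (S n) * x ^ n) (C * C).
Proof.
apply is_series_ext with (2 := is_series_mult _ _ _ _ is_series_c is_series_c
  ex_series_abs_c ex_series_abs_c).
intros n; rewrite sum_conv_pow, cS; reflexivity.
Qed.

Lemma C_eqn : C = 1 + x * (C * C).
Proof.
unfold C at 1; rewrite Series_incr_1; [|exists C; exact is_series_c].
rewrite c0; simpl pow at 1; rewrite Rmult_1_r; f_equal.
rewrite <- (is_series_unique _ _ is_series_c_shift), <- Series_scal_l.
apply Series_ext; intros n; simpl; ring.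
Qed.

(** The equation of [C] gives the square. The sign follows from
    [2 * |x| * |C| <= 2 * / 4 * 2 = 1]. *)
Lemma sqrt_C : sqrt (1 - 4 * x) = 1 - 2 * x * C.
Proof.
replace (1 - 4 * x) with ((1 - 2 * x * C) ^ 2).
  apply sqrt_pow2.
  assert (Rabs (x * C) <= / 4 * 2).
    rewrite Rabs_mult; apply Rmult_le_compat; try apply Rabs_pos; [lra|exact abs_C_le2].
  apply Rabs_le_between in H; lra.
pose proof C_eqn as H; nra.
Qed.

Lemma ex_series_abs_a : ex_series (fun n => Rabs (a n * x ^ n)).
Proof.
assert (x1 : Rabs (Rabs x) < 1) by (rewrite Rabs_Rabsolu; lra).
assert (bound : forall n, a n <= c (S n) + 1).
  intros [|n]; [rewrite cS; simpl; rewrite a0, c0; lra|].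
  assert (0 <= sum_f_R0 (fun i => a i * c (n - i)%nat) n).
    apply cond_pos_sum; intros i; now apply Rmult_le_pos.
  pose proof (aS n); pose proof (c_ge0 (S n)); lra.
apply (ex_series_le (K := R_AbsRing) (V := R_CompleteNormedModule) _
  (fun n => plus (/ Rabs x * Rabs (c (S n) * x ^ (S n))) (Rabs x ^ n))).
  intros n; unfold norm, plus; simpl; unfold abs; simpl.
  rewrite Rabs_Rabsolu, !Rabs_mult, <- RPow_abs.
  rewrite (Rabs_pos_eq _ (a_ge0 n)), (Rabs_pos_eq _ (c_ge0 (S n))).
  replace (/ Rabs x * _ + _) with ((c (S n) + 1) * Rabs x ^ n).
    apply Rmult_le_compat_r; [apply pow_le, Rabs_pos|apply bound].
  field; now apply Rabs_no_R0.
apply (ex_series_plus (K := R_AbsRing) (V := R_NormedModule)).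
  apply (ex_series_scal_l (/ Rabs x) (fun n => Rabs (c (S n) * x ^ S n))).
  apply (ex_series_incr_1 (K := R_AbsRing) (V := R_NormedModule) (fun n => Rabs (c n * x ^ n))), ex_series_abs_c.
now apply ex_series_geom.
Qed.

Let A := Series (fun n => a n * x ^ n).

Lemma is_series_a : is_series (fun n => a n * x ^ n) A.
Proof. apply Series_correct, ex_series_Rabs, ex_series_abs_a. Qed.

Lemma is_series_shift (u : nat -> R) (L : R) : is_series (fun n => u n * x ^ n) L ->
  is_series (fun n => u (S n) * x ^ n) (/ x * (L - u 0%nat)).
Proof.
intros H; apply is_series_ext with (fun n => / x * (u (S n) * x ^ S n)).
  intros n; simpl; field; exact x0.
apply (is_series_scal (/ x) (fun n => u (S n) * x ^ S n) (L - u 0%nat)).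
apply (is_series_incr_1 (K := R_AbsRing) (V := R_NormedModule) (fun n => u n * x ^ n)).
replace (plus _ _) with L; [exact H|unfold plus; simpl; ring].
Qed.

Lemma A_eqn : A * (1 + x * C) = C * C - C + / (1 - x).
Proof.
pose proof (is_series_mult _ _ _ _ is_series_a is_series_c ex_series_abs_a ex_series_abs_c) as AC.
assert (x1 : Rabs x < 1) by lra.
pose proof (is_series_geom x x1) as G.
pose proof (is_series_shift _ _ is_series_a) as SA.
pose proof (is_series_shift (fun n => c (S n)) _ is_series_c_shift) as SC.
pose proof (is_series_plus _ _ _ _ (is_series_plus _ _ _ _ SA AC) is_series_c_shift) as L.
pose proof (is_series_plus _ _ _ _ SC G) as R.
assert (E : / x * (C * C - c 1%nat) + / (1 - x) = / x * (A - a 0%nat) + A * C + C * C).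
  rewrite <- (is_series_unique _ _ R : _ = / x * (C * C - c 1%nat) + / (1 - x)).
  apply is_series_unique; apply is_series_ext with (2 := L).
  intros n; rewrite sum_conv_pow; unfold plus; simpl.
  replace (c (S (S n))) with
    (a (S n) + sum_f_R0 (fun i => a i * c (n - i)%nat) n + c (S n) - 1) by (rewrite aS; ring).
  ring.
rewrite cS, a0 in E; simpl in E; rewrite c0 in E.
pose proof C_eqn as HC.
(* The recurrence starts at index 1, so two series enter shifted, each with a factor [/ x];
   multiplication by [x] removes it. *)
assert (E' : x * (/ x * (C * C - 1 * 1) + / (1 - x)) = x * (/ x * (A - 1) + A * C + C * C)).
  now rewrite E.
assert (x1' : 1 - x <> 0) by (apply Rabs_lt_between in x4; lra).
replace (x * (/ x * (C * C - 1 * 1) + / (1 - x))) with (C * C - 1 + (/ (1 - x) - 1)) in E'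
  by (field; split; assumption).
replace (x * (/ x * (A - 1) + A * C + C * C)) with (A * (1 + x * C) - 1 + x * (C * C)) in E'
  by (field; assumption).
lra.
Qed.

(** The factor [2 + x] is the product of [1 + x C = (3 - sqrt (1 - 4 x)) / 2] and its conjugate
    [(3 + sqrt (1 - 4 x)) / 2]. *)
Lemma generating_function :
  is_series (fun n => a n * x ^ n)
    ((1 - 3 * x + 3 * x ^ 2 + 2 * x ^ 3 + (x ^ 2 + x - 1) * sqrt (1 - 4 * x))
     / (2 * x ^ 2 * (1 - x) * (2 + x))).
Proof.
replace (_ / _) with A; [exact is_series_a|].
rewrite sqrt_C; pose proof A_eqn as HA; pose proof C_eqn as HC.
pose proof (proj1 (Rabs_lt_between _ _) x4) as xb.
assert (pos : 0 < 1 + x * C).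
  assert (Rabs (x * C) <= / 4 * 2).
    rewrite Rabs_mult; apply Rmult_le_compat; try apply Rabs_pos; [lra|exact abs_C_le2].
  apply Rabs_le_between in H; lra.
assert (0 < 2 * x ^ 2 * (1 - x) * (2 + x)).
  pose proof (pow2_gt_0 _ x0); do 2 (apply Rmult_lt_0_compat; [|lra]); lra.
apply Rmult_eq_reg_r with (1 + x * C); [|lra].
rewrite HA; apply Rmult_eq_reg_r with (2 * x ^ 2 * (1 - x) * (2 + x)); [|lra].
transitivity (2 * x ^ 2 * (2 + x) * ((C * C - C) * (1 - x) + 1)); [field; lra|].
transitivity ((1 - 3 * x + 3 * x ^ 2 + 2 * x ^ 3 + (x ^ 2 + x - 1) * (1 - 2 * x * C)) * (1 + x * C));
  [|field; repeat split; lra].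
(* With the root and the denominators cleared, the difference of the two sides is a multiple of the
   quadratic equation of [C]. *)
apply Rminus_diag_uniq.
transitivity (2 * x * (1 + x * (C * C) - C)); [ring|rewrite <- HC; ring].
Qed.
End GeneratingFunction.

Module Transfer.
From mathcomp Require Import all_boot.
Import Combinatorics.

Lemma INR_sum (F : nat -> nat) n :
  INR (\sum_(i < n.+1) F i)%N = sum_f_R0 (fun i => INR (F i)) n.
Proof.
elim: n => [|n IHn]; first by rewrite big_ord1.
by rewrite big_ord_recr plus_INR IHn.
Qed.

Lemma INR_catalanS n : INR (catalan (S n)) =
  sum_f_R0 (fun i => INR (catalan i) * INR (catalan (Nat.sub n i))) n.
Proof.
rewrite catalanS (INR_sum (fun i => catalan i * catalan (n - i))%N).
by apply: PartSum.sum_eq => i _; rewrite mult_INR.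
Qed.

Lemma INR_der_numS n : INR (der_num (S n)) +
  sum_f_R0 (fun i => INR (der_num i) * INR (catalan (Nat.sub n i))) n + INR (catalan (S n))
  = INR (catalan (S (S n))) + 1.
Proof.
rewrite -S_INR -der_num_rec !plus_INR (INR_sum (fun i => der_num i * catalan (n - i))%N).
by congr (_ + _ + _); apply: PartSum.sum_eq => i _; rewrite mult_INR.
Qed.

Lemma a321_der_num n : a321 n = der_num n.
Proof. by case: n => // n; rewrite /a321 Dcount_321. Qed.
End Transfer.

Theorem theorem1p3 :
  (forall n : nat, (1 <= n)%nat -> Dcount n p321 = Dcount n p132) /\
  (forall x : R, x <> 0 -> Rabs x < / 4 ->
     is_series (fun n : nat => INR (a321 n) * x ^ n)
       ((1 - 3 * x + 3 * x ^ 2 + 2 * x ^ 3 + (x ^ 2 + x - 1) * sqrt (1 - 4 * x))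
        / (2 * x ^ 2 * (1 - x) * (2 + x)))).
Proof.
split.
  intros n _; now rewrite Combinatorics.Dcount_321, Combinatorics.Dcount_132.
intros x x0 x4.
apply is_series_ext with (fun n => INR (Combinatorics.der_num n) * x ^ n).
  intros n; now rewrite Transfer.a321_der_num.
apply generating_function with (fun n => INR (Combinatorics.catalan n)); trivial.
- intros n; apply pos_INR.
- exact Transfer.INR_catalanS.
- intros n; apply pos_INR.
- exact Transfer.INR_der_numS.
Qed.
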